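(* The equality $E_{(1,\infty)}(\phi)=E_\infty(\phi)$ holds for every $\phi\in\mathrm{Homeo}(M,\alpha)$.
   Context: Setting. $M$ is a closed (compact, without boundary), connected smooth manifold of dimension $2n+1$ with a cooriented contact structure $\xi=\ker\alpha$, where $\alpha$ is a fixed contact form with Reeb vector field $R$, and $\nu_\alpha=\alpha\wedge(d\alpha)^n$. A smooth strictly contact isotopy is a smooth isotopy $\Phi=\{\phi_t\}_{0\le t\le1}$ with $\phi_0=\mathrm{id}$ and $\phi_t^*\alpha=\alpha$ for all $t$; if $\frac{d}{dt}\phi_t=X_t\circ\phi_t$, its Hamiltonian is $H_t=\alpha(X_t)$, and one writes $\Phi=\Phi_H=\{\phi_H^t\}$. The Hamiltonians so obtained are exactly the smooth basic functions $H\colon[0,1]\times M\to\mathbb R$ ($dH_t(R)=0$ for all $t$). Then $(\Phi_H,H)$ is a smooth strictly contact dynamical system. For a function $H$ on $M$, $\|H\|=\max_M H-\min_M H+\left|\frac{1}{\int_M\nu_\alpha}\int_M H\,\nu_\alpha\right|$; for $H\colon[0,1]\times M\to\mathbb R$, $\|H\|_{(1,\infty)}=\int_0^1\|H_t\|\,dt$ and $\|H\|_\infty=\max_t\|H_t\|$. A pair $(\Phi,H)$ of a continuous isotopy of homeomorphisms and a function $H\colon[0,1]\times M\to\mathbb R$ is a topological strictly contact dynamical system if there are smooth strictly contact dynamical systems $(\Phi_{H_i},H_i)$ with $\Phi_{H_i}\to\Phi$ uniformly and $\|H-H_i\|_{(1,\infty)}\to0$ ($H\in L^1([0,1],C^0(M))$);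 it is a continuous strictly contact dynamical system if there is such a sequence with $\|H-H_i\|_\infty\to0$ instead. One writes $\Phi=\Phi_H=\{\phi_H^t\}$. $\mathrm{Homeo}(M,\alpha)$ is the group of time-one maps $\phi_H^1$ of topological strictly contact dynamical systems; it coincides with the group of time-one maps of continuous strictly contact dynamical systems. For $\phi\in\mathrm{Homeo}(M,\alpha)$, $E_{(1,\infty)}(\phi)=\inf\|H\|_{(1,\infty)}$ over all topological strictly contact dynamical systems $(\Phi_H,H)$ with $\phi_H^1=\phi$, and $E_\infty(\phi)=\inf\|H\|_\infty$ over all continuous strictly contact dynamical systems $(\Phi_H,H)$ with $\phi_H^1=\phi$. *)

(* Defs.v *)
From HB Require Import structures.
From mathcomp Require Import all_boot all_order all_algebra perm.
From mathcomp Require Import all_classical all_reals all_analysis.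

Set Implicit Arguments.
Unset Strict Implicit.
Unset Printing Implicit Defensive.

Import Order.TTheory GRing.Theory Num.Theory.
Import numFieldNormedType.Exports.

Local Open Scope classical_set_scope.
Local Open Scope ring_scope.

Section Smoothness.
Context {R : realType} {V W : normedModType R}.

(* Meant for an open set U. *)
Fixpoint Ck (k : nat) (U : set V) (f : V -> W) : Prop :=
  match k with
  | 0 => forall x, U x -> {for x, continuous f}
  | k'.+1 => (forall x, U x -> differentiable f x) /\
             (forall v, Ck k' U ('D_v f))
  end.

Definition smooth_on (U : set V) (f : V -> W) : Prop := forall k, Ck k U f.

(* Smoothness of f at p relative to a set A that need not be open: near p, f
   is the restriction to A of a map that is smooth on an open set. *)
Definition smooth_at (A : set V) (f : V -> W) (p : V) : Prop :=
  exists (U : set V) (g : V -> W),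
    [/\ open U, U p, smooth_on U g & forall q, U q -> A q -> f q = g q].

End Smoothness.

(* Charts are total maps; [coord i] is used only on [dom i], and [chart_inv i]
   only on [coord i @` dom i]. *)
Record smooth_atlas (R : realType) (m : nat) (M : topologicalType) := SmoothAtlas {
  chart : Type ;
  dom : chart -> set M ;
  coord : chart -> M -> 'rV[R]_m ;
  chart_inv : chart -> 'rV[R]_m -> M ;
  dom_open : forall i, open (dom i) ;
  img_open : forall i, open (coord i @` dom i) ;
  coordK : forall i x, dom i x -> chart_inv i (coord i x) = x ;
  coord_continuous : forall i, {within dom i, continuous (coord i)} ;
  chart_inv_continuous :
    forall i, {within coord i @` dom i, continuous (chart_inv i)} ;
  dom_cover : forall x, exists i, dom i x ;
  transition_smooth : forall i j,
    smooth_on (coord i @` (dom i `&` dom j)) (coord j \o chart_inv i)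
}.

Definition pairing (R : realType) (m : nat) (a v : 'rV[R]_m) : R :=
  \sum_(k < m) a ord0 k * v ord0 k.

(* [coef i p] is the row of coefficients, at the point of coordinates p in the
   chart i, of a smooth 1-form. *)
Record one_form (R : realType) (m : nat) (M : topologicalType)
    (A : smooth_atlas R m M) := OneForm {
  coef : chart A -> 'rV[R]_m -> 'rV[R]_m ;
  coef_smooth : forall i, smooth_on (coord i @` dom i) (coef i) ;
  coef_compat : forall i j x, dom i x -> dom j x -> forall v : 'rV[R]_m,
    pairing (coef i (coord i x)) v =
    pairing (coef j (coord j x)) ('D_v (coord j \o chart_inv i) (coord i x))
}.

Section ContactForm.
Context {R : realType} {n : nat} {M : topologicalType}.
Context {A : smooth_atlas R n.*2.+1 M} (alpha : one_form A).

(* d(alpha)(e_k, e_l) in the chart i *)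
Definition dform (i : chart A) (p : 'rV[R]_n.*2.+1) (k l : 'I_n.*2.+1) : R :=
  'D_(delta_mx ord0 k) (fun q => coef alpha i q ord0 l) p -
  'D_(delta_mx ord0 l) (fun q => coef alpha i q ord0 k) p.

(* (alpha /\ (d alpha)^n)(e_0, ..., e_2n) in the chart i, by the alternating
   sum that defines the wedge product of forms of degrees 1, 2, ..., 2. *)
Definition contact_density (i : chart A) (p : 'rV[R]_n.*2.+1) : R :=
  (2 ^- n) * \sum_(s : {perm 'I_n.*2.+1})
    (-1) ^+ s * coef alpha i p ord0 (s ord0) *
    \prod_(k < n) dform i p (s (inord k.*2.+1)) (s (inord k.*2.+2)).

Definition contact_form : Prop :=
  forall i x, dom i x -> contact_density i (coord i x) != 0.

End ContactForm.

(* Iterated Lebesgue integral over R^m. It is applied only to continuous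
   functions with compact support. *)
Fixpoint rV_integral (R : realType) (m : nat) : ('rV[R]_m -> R) -> R :=
  match m with
  | 0 => fun f => f 0
  | k.+1 => fun f => \int[@lebesgue_measure R]_x
      rV_integral (fun v : 'rV[R]_k => f (row_mx (x%:M : 'rV[R]_1) v))
  end.

Notation borel M := (g_sigma_algebraType (@open M)).

Section ContactVolume.
Context {R : realType} {n : nat} {M : pseudoPMetricType R}.
Context {A : smooth_atlas R n.*2.+1 M}.

(* nu is the Borel measure f |-> \int_M f nu_alpha, where M is oriented by the
   volume form nu_alpha = alpha /\ (d alpha)^n, so that in any chart
   nu_alpha has density |contact_density|. As M is compact, the closed
   supports below are compact. *)
Definition contact_volume (alpha : one_form A)
    (nu : {finite_measure set (borel M) -> \bar R}) : Prop :=
  forall (i : chart A) (f : M -> R), continuous f ->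
    closure [set x | f x != 0] `<=` dom i ->
    \int[nu]_x f x =
    rV_integral (fun p => \1_(coord i @` dom i) p *
      (f (chart_inv i p) * `|contact_density alpha i p|)).

End ContactVolume.

Section ContactDynamics.
Context {R : realType} {n : nat} {M : pseudoPMetricType R}.
Context {A : smooth_atlas R n.*2.+1 M}.
Variable alpha : one_form A.
Variable nu : {finite_measure set (borel M) -> \bar R}.

(* Isotopies and Hamiltonians are functions on R x M of which only the
   restriction to [0, 1] x M matters. *)
Let I : set R := `[0, 1].
Implicit Types (Phi Psi : R -> M -> M) (H : R -> M -> R) (phi : M -> M).

Definition isotopy_continuous Phi : Prop :=
  {within I `*` setT, continuous (fun q : R * M => Phi q.1 q.2)}.

Definition isotopy_smooth Phi : Prop :=
  isotopy_continuous Phi /\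
  forall t x (i j : chart A), I t -> dom i x -> dom j (Phi t x) ->
    smooth_at ((I : set R^o) `*` setT)
      (fun q : R^o * 'rV[R]_n.*2.+1 => coord j (Phi q.1 (chart_inv i q.2)))
      (t : R^o, coord i x).

Definition inverse_isotopies Phi Psi : Prop :=
  forall t, I t -> cancel (Phi t) (Psi t) /\ cancel (Psi t) (Phi t).

Definition smooth_isotopy Phi : Prop :=
  isotopy_smooth Phi /\
  exists Psi, isotopy_smooth Psi /\ inverse_isotopies Phi Psi.

Definition topological_isotopy Phi : Prop :=
  isotopy_continuous Phi /\
  exists Psi, isotopy_continuous Psi /\ inverse_isotopies Phi Psi.

(* phi^* alpha = alpha *)
Definition preserves_form phi : Prop :=
  forall x (i j : chart A), dom i x -> dom j (phi x) ->
  forall v : 'rV[R]_n.*2.+1,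
    pairing (coef alpha j (coord j (phi x)))
      ('D_v (coord j \o phi \o chart_inv i) (coord i x)) =
    pairing (coef alpha i (coord i x)) v.

Definition strictly_contact_isotopy Phi : Prop :=
  [/\ smooth_isotopy Phi, Phi 0 = id & forall t, I t -> preserves_form (Phi t)].

(* H_t o phi_t = alpha (d phi_t / dt); the time derivative v is one-sided at
   the end points of [0, 1]. *)
Definition hamiltonian_of Phi H : Prop :=
  forall t x (j : chart A), I t -> dom j (Phi t x) ->
  exists2 v : 'rV[R]_n.*2.+1,
    (s - t)^-1 *: (coord j (Phi s x) - coord j (Phi t x))
      @[s --> within I t^'] --> v &
    H t (Phi t x) = pairing (coef alpha j (coord j (Phi t x))) v.

Definition smooth_contact_system Phi H : Prop :=
  strictly_contact_isotopy Phi /\ hamiltonian_of Phi H.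

(* For continuous h, sup and inf are the maximum and minimum over compact M. *)
Definition space_norm (h : M -> R) : R :=
  sup (range h) - inf (range h) +
  `|(fine (nu setT))^-1 * \int[nu]_x h x|.

Definition norm_1infty H : \bar R :=
  (\int[@lebesgue_measure R]_(t in I) (space_norm (H t))%:E)%E.

Definition norm_infty H : \bar R :=
  ereal_sup [set (space_norm (H t))%:E | t in I].

(* H represents an element of L^1([0, 1], C^0(M)). As C^0(M) is separable,
   measurability of t |-> H_t amounts to that of all its evaluations. *)
Definition L1C0 H : Prop :=
  [/\ forall t, I t -> continuous (H t),
      forall x, measurable_fun I (H ^~ x)
    & (norm_1infty H < +oo)%E].

Definition uniform_limit (Phis : nat -> R -> M -> M) Phi : Prop :=
  {uniform I `*` setT,
    (fun k (q : R * M) => Phis k q.1 q.2) @ \oo -->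
    (fun q : R * M => Phi q.1 q.2)}.

Definition topological_contact_system Phi H : Prop :=
  [/\ topological_isotopy Phi, L1C0 H &
   exists (Phis : nat -> R -> M -> M) (Hs : nat -> R -> M -> R),
   [/\ forall k, smooth_contact_system (Phis k) (Hs k),
       uniform_limit Phis Phi
     & norm_1infty (fun t x => H t x - Hs k t x) @[k --> \oo] --> 0%E]].

Definition continuous_contact_system Phi H : Prop :=
  [/\ topological_isotopy Phi,
      {within I `*` setT, continuous (fun q : R * M => H q.1 q.2)} &
   exists (Phis : nat -> R -> M -> M) (Hs : nat -> R -> M -> R),
   [/\ forall k, smooth_contact_system (Phis k) (Hs k),
       uniform_limit Phis Phi
     & norm_infty (fun t x => H t x - Hs k t x) @[k --> \oo] --> 0%E]].

Definition Homeo : set (M -> M) :=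
  [set phi | exists Phi H, topological_contact_system Phi H /\ Phi 1 = phi].

Definition energy_1infty phi : \bar R :=
  ereal_inf [set e | exists Phi H,
    [/\ topological_contact_system Phi H, Phi 1 = phi & e = norm_1infty H]].

Definition energy_infty phi : \bar R :=
  ereal_inf [set e | exists Phi H,
    [/\ continuous_contact_system Phi H, Phi 1 = phi & e = norm_infty H]].

End ContactDynamics.

(* Main.v *)
(* A continuous system is a topological one and the L^(1,oo) norm is at most the
   L^oo norm, which gives one inequality. For the other, let smooth systems
   (phi_i, H_i) converge to (Phi, H). Reparametrizing time by z, with
   z' ||H_z|| almost constant, brings the L^oo norm of a smooth Hamiltonian down to
   its L^(1,oo) norm up to epsilon without changing the time-one map. The H_i so
   reparametrized need not converge, so along a sparse subsequence one writes
   phi_i(k) = phi_i(0) (phi_i(0)^-1 phi_i(1)) ... (phi_i(k-1)^-1 phi_i(k)) and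
   reparametrizes each factor separately. The factor phi_i^-1 phi_j is generated
   by (H_j - H_i) o phi_i, so the Hamiltonians of the partial products are
   uniformly Cauchy, with norms bounded by that of H_i(0) plus a small geometric
   series. The estimate sup |h| <= ||h|| <= 3 sup |h| replaces the invariance of the
   norm under strictly contact maps: only smallness of the factors matters. *)
Require Import Defs.
From HB Require Import structures.
From mathcomp Require Import all_boot all_order all_algebra perm.
From mathcomp Require Import all_classical all_reals all_analysis.
From mathcomp Require Import measurable_realfun.
From mathcomp Require Import ring lra zify.

Set Implicit Arguments.
Unset Strict Implicit.
Unset Printing Implicit Defensive.

Import Order.TTheory GRing.Theory Num.Theory.
Import numFieldNormedType.Exports.
(* [Defs.coord] and [Defs.coord_continuous] take precedence over their
   MathComp homonyms. *)
Import Defs.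

Local Open Scope classical_set_scope.
Local Open Scope ring_scope.

(** * Maps of class C^k *)

(** The speed of the time change for H_i depends on t |-> ||H_i(t)||, and L^1 convergence does not
    control these functions pointwise; hence the factorization. New factors are put on the right:
    the Hamiltonian of F o Q is that of F plus K o F^-1, so the increment has the sup norm of K
    whatever F is. The price is that F o Q is near F only through the uniform continuity of F,
    whereas F^-1 receives its factor on the left and needs nothing of the kind. The choices look
    circular: the time change of a factor phi_i^-1 phi_j is known only once j is, while i must be so
    large that the product ending in phi_i tolerates every later factor. So the estimates are made
    for all j >= i and for independent times in the different factors; uniform convergence of the
    phi_j supplies the equicontinuity that this requires. Passing from the norm to the sup norm
    requires nu(M) > 0, since otherwise the mean contributes nothing and constants have norm 0; this
    is drawn from the chart formula for nu, tested on a bump function. *)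

Section CkCalculus.
Context {R : realType}.

Lemma near_eq_differentiable (V W : normedModType R) (f g : V -> W) (x : V) :
  (\near x, f x = g x) -> differentiable f x -> differentiable g x.
Proof.
move=> fg df; have [dfc dfE] := (diff_locallyP _ _).1 df.
have fgx : f x = g x := nbhs_singleton fg.
have E : g \o shift x = cst (g x) + 'd f x +o_ 0 id.
  apply/eqaddoP => _/posnumP[e].
  move/eqaddoP : dfE => /(_ e%:num [gt0 of e%:num]) dfE.
  have fg0 : \forall h \near (0 : V), f (h + x) = g (h + x).
    by move: fg; rewrite (near_shift 0) subr0.
  near=> h.
  rewrite (_ : (_ - _) h = (f \o shift x - (cst (f x) + 'd f x)) h).
    by near: h.
  have fgh : f (h + x) = g (h + x) by near: h.
  by rewrite !fctE /= -fgx -fgh.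
have dE : 'd g x = 'd f x :> (V -> W) by apply: diff_unique.
by apply/diff_locallyP; rewrite dE.
Unshelve. all: by end_near. Qed.

Section Ck_basic.
Context {V W : normedModType R}.
Implicit Types (U : set V) (f g : V -> W) (k : nat).

(** As U is open, the two maps have the same germ at each of its points. Differentiation rules hold
    only on U, and the inductions below replace a derivative by its formula through this lemma. *)
Lemma Ck_ext k U f g : open U -> (forall x, U x -> f x = g x) ->
  Ck k U f -> Ck k U g.
Proof.
move=> oU; elim: k f g => [|k IH] f g fg /=.
  move=> cf x Ux; have nU : \near x, f x = g x.
    by near=> y; apply: fg; near: y; exact: open_nbhs_nbhs.
  rewrite /prop_for /continuous_at -(fg _ Ux).
  apply: (cvg_trans _ (cf x Ux)); apply: near_eq_cvg.
  by apply: filterS nU.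
have nfg x : U x -> \near x, f x = g x.
  by move=> Ux; near=> y; apply: fg; near: y; exact: open_nbhs_nbhs.
move=> [df Cf]; split=> [x Ux|v].
  by apply: near_eq_differentiable (df x Ux); exact: nfg.
apply: IH (Cf v) => x Ux; apply: near_eq_derive; exact: nfg.
Unshelve. all: by end_near. Qed.

Lemma Ck_sub k U U' f : U' `<=` U -> Ck k U f -> Ck k U' f.
Proof.
move=> UU; elim: k f => [|k IH] f /=; first by move=> cf x /UU; exact: cf.
by move=> [df Cf]; split=> [x /UU|v]; [exact: df|exact/IH/Cf].
Qed.

Lemma Ck_pred k U f : Ck k.+1 U f -> Ck k U f.
Proof.
elim: k f => [|k IH] f /= [df Cf].
  by move=> x Ux; exact/differentiable_continuous/df.
by split=> // v; exact/IH/Cf.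
Qed.

Lemma Ck_cst k U (a : W) : Ck k U (cst a).
Proof.
elim: k a => [|k IH] a /=; first by move=> x _; exact: cvg_cst.
split=> [x _|v]; first exact: differentiable_cst.
rewrite (_ : (fun x => _) = cst 0) //; apply/funext => x /=.
exact: derive_cst.
Qed.

Lemma CkD k U f g : open U -> Ck k U f -> Ck k U g -> Ck k U (f \+ g).
Proof.
move=> oU; elim: k f g => [|k IH] f g /=.
  by move=> cf cg x Ux; apply: cvgD; [exact: cf|exact: cg].
move=> [df Cf] [dg Cg]; split=> [x Ux|v].
  by apply: differentiableD; [exact: df|exact: dg].
apply: Ck_ext (IH _ _ (Cf v) (Cg v)) => // x Ux /=.
by rewrite [RHS]deriveD //; apply: diff_derivable; [exact: df|exact: dg].
Qed.

Lemma Ck_sum (J : Type) (r : seq J) k U (F : J -> V -> W) : open U ->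
  (forall j, Ck k U (F j)) -> Ck k U (fun x => \sum_(j <- r) F j x).
Proof.
move=> oU CF; elim: r => [|j r IH].
  rewrite (_ : (fun _ => _) = cst 0); first exact: Ck_cst.
  by apply/funext => x; rewrite big_nil.
rewrite (_ : (fun _ => _) = F j \+ (fun x => \sum_(i <- r) F i x)).
  exact: CkD.
by apply/funext => x /=; rewrite big_cons.
Qed.

Lemma differentiable_bigsum (J : Type) (r : seq J) (F : J -> V -> W) x :
  (forall j, differentiable (F j) x) ->
  differentiable (fun x => \sum_(j <- r) F j x) x.
Proof.
move=> dF; elim: r => [|j r IH].
  rewrite (_ : (fun _ => _) = cst 0); first exact: differentiable_cst.
  by apply/funext => y; rewrite big_nil.
rewrite (_ : (fun _ => _) = F j \+ (fun x => \sum_(i <- r) F i x)).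
  exact: differentiableD.
by apply/funext => y /=; rewrite big_cons.
Qed.

End Ck_basic.

Lemma derive_lin_comp (V W Z : normedModType R) (L : {linear W -> Z})
    (f : V -> W) (x v : V) : continuous L -> differentiable f x ->
  'D_v (L \o f) x = L ('D_v f x).
Proof.
move=> cL df; have dL := linear_differentiable (f x) cL.
rewrite deriveE; last exact: differentiable_comp.
by rewrite diff_comp // diff_lin //= deriveE.
Qed.

Lemma Ck_lin (V W Z : normedModType R) (L : {linear W -> Z}) k (U : set V)
    (f : V -> W) : open U -> continuous L -> Ck k U f -> Ck k U (L \o f).
Proof.
move=> oU cL; elim: k f => [|k IH] f /=.
  by move=> cf x Ux; apply: continuous_comp (cf x Ux) _; exact: cL.
move=> [df Cf]; split=> [x Ux|v].
  by apply: differentiable_comp (df x Ux) _; exact: linear_differentiable.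
apply: Ck_ext (IH _ (Cf v)) => // x Ux /=.
by rewrite derive_lin_comp //; exact: df.
Qed.

Lemma CkM (V : normedModType R) k (U : set V) (f g : V -> R^o) : open U ->
  Ck k U f -> Ck k U g -> Ck k U (f \* g).
Proof.
move=> oU; elim: k f g => [|k IH] f g /=.
  by move=> cf cg x Ux; apply: cvgM; [exact: cf|exact: cg].
move=> [df Cf] [dg Cg]; split=> [x Ux|v].
  by apply: differentiableM; [exact: df|exact: dg].
have Cf' : Ck k U f by apply: Ck_pred; split.
have Cg' : Ck k U g by apply: Ck_pred; split.
apply: Ck_ext (CkD oU (IH _ _ Cf' (Cg v)) (IH _ _ Cg' (Cf v))) => // x Ux /=.
by rewrite [RHS]deriveM //; apply: diff_derivable; [exact: df|exact: dg].
Qed.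

(** A finite spanning family with continuous coordinates. [Ck] speaks of derivatives in fixed
    directions, whereas the chain rule yields the derivative of f in the moving direction D_v g(x);
    a frame expands the latter in fixed directions. *)
Record frame (W : normedModType R) := Frame {
  fidx : finType ;
  fvec : fidx -> W ;
  fcrd : fidx -> {linear W -> R^o} ;
  fcrd_continuous : forall j, continuous (fcrd j) ;
  frameE : forall w, w = \sum_j fcrd j w *: fvec j }.
Arguments fcrd {W} f j.
Arguments fvec {W} f j.

Section FrameSmooth.
Context {V W : normedModType R} (B : frame W).

Lemma differentiable_frame (g : V -> W) x :
  (forall j, differentiable (fcrd B j \o g) x) -> differentiable g x.
Proof.
move=> dg; rewrite (_ : g = fun x => \sum_j (fcrd B j \o g) x *: fvec B j).
  by apply: differentiable_bigsum => j; apply: differentiableZl.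
by apply/funext => y; exact: frameE.
Qed.

Lemma derive_frame (f : W -> R^o) y w : differentiable f y ->
  'D_w f y = \sum_j fcrd B j w * 'D_(fvec B j) f y.
Proof.
move=> df; rewrite deriveE // [in LHS](frameE B w) linear_sum /=.
by apply: eq_bigr => j _; rewrite linearZ /= deriveE.
Qed.

Lemma Ck_frame k (U : set V) (g : V -> W) : open U ->
  (forall j, Ck k U (fcrd B j \o g)) -> Ck k U g.
Proof.
move=> oU; elim: k g => [|k IH] g /= Cg.
  move=> x Ux; rewrite (_ : g = fun x => \sum_j (fcrd B j \o g) x *: fvec B j).
    apply: cvg_big => [|j _]; first exact: add_continuous.
    by apply: cvgZr_tmp; exact: Cg.
  by apply/funext => y; exact: frameE.
have dg x : U x -> differentiable g x.
  by move=> Ux; apply: differentiable_frame => j; exact: (Cg j).1.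
split=> // v; apply: IH => j.
apply: Ck_ext ((Cg j).2 v) => // x Ux /=.
by rewrite derive_lin_comp //; [exact: fcrd_continuous|exact: dg].
Qed.

(** The derivative of f o g along v is the sum over j of the j-th coordinate of D_v g times (D_(e_j)
    f) o g. The induction hypothesis covers the second factor, and for scalar f the product rule
    suffices. *)
Lemma Ck_comp_scal k (U : set V) (U' : set W) (g : V -> W) (f : W -> R^o) :
  open U -> (forall x, U x -> U' (g x)) -> Ck k U g -> Ck k U' f ->
  Ck k U (f \o g).
Proof.
move=> oU UU'; elim: k f => [|k IH] f /=.
  move=> cg cf x Ux; apply: continuous_comp (cg x Ux) _; apply: cf; exact: UU'.
move=> [dg Cg] [df Cf]; split=> [x Ux|v].
  by apply: differentiable_comp; [exact: dg|exact/df/UU'].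
have Cg' : Ck k U g by apply: Ck_pred; split.
have H : Ck k U (fun x => \sum_j
    ((fcrd B j \o 'D_v g) \* ('D_(fvec B j) f \o g)) x).
  apply: Ck_sum => // j; apply: CkM => //; last exact: IH.
  by apply: Ck_lin => //; exact: fcrd_continuous.
apply: Ck_ext H => // x Ux /=.
have dfx : differentiable f (g x) by exact/df/UU'.
have dgx := dg x Ux.
rewrite [RHS]deriveE; last exact: differentiable_comp.
rewrite diff_comp //= -[in RHS]deriveE // -deriveE //.
exact/esym/derive_frame.
Qed.

End FrameSmooth.

Lemma Ck_comp (V W Z : normedModType R) (BW : frame W) (BZ : frame Z) k
    (U : set V) (U' : set W) (g : V -> W) (f : W -> Z) :
  open U -> open U' -> (forall x, U x -> U' (g x)) ->
  Ck k U g -> Ck k U' f -> Ck k U (f \o g).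
Proof.
move=> oU oU' UU' Cg Cf; apply: (Ck_frame (B := BZ)) => // j.
apply: (Ck_comp_scal BW oU UU' Cg (f := fcrd BZ j \o f)).
by apply: Ck_lin => //; exact: fcrd_continuous.
Qed.

End CkCalculus.

(** * Coordinates on R, R^m and R x R^m *)

Section Frames.
Context {R : realType}.

Lemma frame_R_subproof (w : R^o) : w = \sum_(j : unit) (idfun : {linear R^o -> R^o}) w *: (1 : R^o).
Proof. by rewrite (big_pred1 tt) => [|[]] //=; rewrite [RHS]mulr1. Qed.

Definition frame_R : frame R^o :=
  @Frame R R^o unit (fun=> 1) (fun=> idfun) (fun _ _ => cvg_id) frame_R_subproof.

Section RowFrame.
Variable m : nat.

Definition rV_crd (j : 'I_m) (v : 'rV[R]_m) : R^o := v ord0 j.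

Fact rV_crd_linear j : linear (rV_crd j).
Proof. by move=> a u v; rewrite /rV_crd !mxE. Qed.

HB.instance Definition _ j := GRing.isLinear.Build _ _ _ _ (rV_crd j) (rV_crd_linear j).

Lemma rV_crd_continuous j : continuous (rV_crd j).
Proof. exact: matrix_normedtype.coord_continuous. Qed.

Lemma rV_frameE (w : 'rV[R]_m) : w = \sum_j rV_crd j w *: delta_mx ord0 j.
Proof. exact: row_sum_delta. Qed.

Definition frame_rV : frame 'rV[R]_m :=
  Frame rV_crd_continuous rV_frameE.

Let T := (R^o * 'rV[R]_m)%type.

Definition prod_crd (j : unit + 'I_m) (q : T) : R^o :=
  match j with inl _ => q.1 | inr j => rV_crd j q.2 end.

Fact prod_crd_linear j : linear (prod_crd j).
Proof. by case: j => [[]|j] a u v //=; rewrite linearP. Qed.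

HB.instance Definition _ j := GRing.isLinear.Build _ _ _ _ (prod_crd j) (prod_crd_linear j).

Lemma prod_crd_continuous j : continuous (prod_crd j).
Proof.
case: j => [[]|j] q /=; first exact: cvg_fst.
by apply: continuous_comp; [exact: cvg_snd|exact: rV_crd_continuous].
Qed.

Definition prod_vec (j : unit + 'I_m) : T :=
  match j with inl _ => (1, 0) | inr j => (0, delta_mx ord0 j) end.

Lemma prod_frameE (q : T) : q = \sum_j prod_crd j q *: prod_vec j.
Proof.
rewrite big_sumType /= (big_pred1 tt) => [|[]] //.
case: q => t v; rewrite [in LHS](rV_frameE v) /=.
have -> : \sum_(j < m) rV_crd j v *: ((0, delta_mx ord0 j) : T) =
    (0, \sum_j rV_crd j v *: delta_mx ord0 j).
  elim/big_rec2: _ => [//|j y1 y2 _ ->].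
  by congr pair; rewrite /= scaler0 add0r.
by congr pair; rewrite /= ?scaler0 ?add0r // addr0 [RHS]mulr1.
Qed.

Definition frame_prod : frame T := Frame prod_crd_continuous prod_frameE.

End RowFrame.

Section SmoothMaps.
Context {V W : normedModType R}.

Lemma Ck_id k (U : set V) : Ck k U id.
Proof.
case: k => [|k] /=; first by move=> x _; exact: cvg_id.
split=> [x _|v]; first exact: ex_diff.
rewrite (_ : 'D_v id = cst v); first exact: Ck_cst.
by apply/funext => x; rewrite derive_id.
Qed.

Lemma Ck_linear k (U : set V) (L : {linear V -> W}) : open U -> continuous L ->
  Ck k U L.
Proof. by move=> oU cL; exact: (Ck_lin oU cL (Ck_id k U)). Qed.

Lemma smooth_on_sub (U U' : set V) (f : V -> W) : U' `<=` U ->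
  smooth_on U f -> smooth_on U' f.
Proof. by move=> UU sf k; exact: Ck_sub (sf k). Qed.

Lemma smooth_on_continuous (U : set V) (f : V -> W) x : smooth_on U f -> U x ->
  {for x, continuous f}.
Proof. by move=> sf; exact: (sf 0%N). Qed.

Lemma smooth_on_differentiable (U : set V) (f : V -> W) x :
  smooth_on U f -> U x -> differentiable f x.
Proof. by move=> sf; exact: (sf 1%N).1. Qed.

Lemma smooth_on_derive (U : set V) (f : V -> W) v :
  smooth_on U f -> smooth_on U ('D_v f).
Proof. by move=> sf k; exact: (sf k.+1).2. Qed.

End SmoothMaps.

Lemma smooth_on_pair m (V : normedModType R) (U : set V) (a : V -> R^o)
    (g : V -> 'rV[R]_m) : open U -> smooth_on U a -> smooth_on U g ->
  smooth_on U (fun q => (a q, g q)).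
Proof.
move=> oU sa sg k; apply: (Ck_frame (B := frame_prod m)) => // -[[]|j].
  exact: sa.
exact: (Ck_lin oU (@rV_crd_continuous m j) (sg k)).
Qed.

Lemma smooth_on_fst (V W : normedModType R) (U : set (V * W)) : open U ->
  smooth_on U (fst : V * W -> V).
Proof. by move=> oU k; apply: (@Ck_linear _ _ k U fst oU) => q; exact: cvg_fst. Qed.

Lemma smooth_on_snd (V W : normedModType R) (U : set (V * W)) : open U ->
  smooth_on U (snd : V * W -> W).
Proof. by move=> oU k; apply: (@Ck_linear _ _ k U snd oU) => q; exact: cvg_snd. Qed.

End Frames.

(** * Strictly contact systems in charts *)

Section UnitTime.
Context {R : realType}.
Local Notation I := (`[0%R, 1%R]%classic : set R).

(** Neighbourhoods are taken in the whole of R x M, with membership of the time in [0, 1] as a side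
    condition: in this form continuity combines easily with charts and with composition of
    isotopies. *)
Lemma within_I_continuousP (M Y : topologicalType) (F : R -> M -> Y) :
  {within I `*` setT, continuous (fun q : R * M => F q.1 q.2)} <->
  forall t x, I t -> forall B, nbhs (F t x) B ->
    \forall q \near (t, x), I q.1 -> B (F q.1 q.2).
Proof.
split.
  move=> /subspace_continuousP cF t x It B FB.
  have : within (I `*` setT) (nbhs (t, x)) ((fun q => F q.1 q.2) @^-1` B).
    exact: cF (t, x) (conj It Logic.I) B FB.
  by rewrite /within /=; apply: filterS => q + Iq; apply; split.
move=> cF; apply/subspace_continuousP => -[t x] [/= It _] B FB.
rewrite /= /fmap /= /within /=.
by have := cF t x It B FB; apply: filterS => q + [Iq _]; exact.
Qed.

Lemma isotopy_continuousP (M : pseudoPMetricType R) (F : R -> M -> M) :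
  isotopy_continuous F <-> forall t x, I t -> forall B, nbhs (F t x) B ->
    \forall q \near (t, x), I q.1 -> B (F q.1 q.2).
Proof. exact: within_I_continuousP. Qed.

(** Makes time derivatives unique, also at the end points. A step of length at most 1/2 towards the
    farther end point stays in [0, 1]. *)
Lemma proper_within_I (t : R) : I t -> ProperFilter (within I t^').
Proof.
move=> It; apply: Build_ProperFilter_ex => P.
rewrite /= withinE /dnbhs => -[V tV PV].
move: tV; rewrite withinE => -[W tW VW].
have [e /= e0 eW] := (nbhs_ballP _ _).1 tW.
suff [s [st sI sne]] : exists s, [/\ ball t e s, I s & s != t].
  exists s; suff : (P `&` I) s by case.
  rewrite PV; split=> //.
  suff : (V `&` (fun y => y != t)) s by case.
  by rewrite VW; split=> //; exact: eW.
move: It; rewrite /= in_itv /= => /andP[t0 t1].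
pose d := Num.min (e / 2) (1 / 2).
have d0 : 0 < d by rewrite lt_min !divr_gt0.
have de : d < e.
  by apply: (@le_lt_trans _ _ (e / 2)); [rewrite ge_min lexx|lra].
have d1 : d <= 1 / 2 by rewrite ge_min lexx orbT.
have [t2|t2] := leP t (1 / 2).
  exists (t + d); split; last by rewrite -subr_eq0 addrAC subrr add0r gt_eqF.
    by rewrite /ball /= opprD addrA subrr sub0r normrN gtr0_norm.
  by rewrite /= in_itv /=; apply/andP; split; lra.
exists (t - d); split; last by rewrite -subr_eq0 addrAC subrr add0r oppr_eq0 gt_eqF.
  by rewrite /ball /= opprB addrC subrK gtr0_norm.
by rewrite /= in_itv /=; apply/andP; split; lra.
Qed.

Lemma within_I_shift (t : R) (P : set R) : (\forall h \near 0^', P h) ->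
  \forall s \near within I t^', P (s - t).
Proof.
rewrite !near_withinE => -[e /= e0 eP]; exists e => //= s.
rewrite /ball /= => st sne Is; apply: eP; last by rewrite subr_eq0.
by rewrite /ball /= sub0r normrN distrC.
Qed.

End UnitTime.

Section Charts.
Context {R : realType} {m : nat} {M : topologicalType} (A : smooth_atlas R m M).

Lemma dom_nbhs (i : chart A) x : dom i x -> nbhs x (dom i).
Proof. by move=> ix; apply: open_nbhs_nbhs; split=> //; exact: dom_open. Qed.

Lemma img_nbhs (i : chart A) x : dom i x -> nbhs (coord i x) (coord i @` dom i).
Proof.
by move=> ix; apply: open_nbhs_nbhs; split; [exact: img_open|exists x].
Qed.

Lemma coord_cont (i : chart A) x : dom i x -> {for x, continuous (coord i)}.
Proof.
move=> ix; have := @coord_continuous _ _ _ A i.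
by rewrite continuous_open_subspace; [apply; exact: mem_set|exact: dom_open].
Qed.

Lemma chart_inv_cont (i : chart A) p : (coord i @` dom i) p ->
  {for p, continuous (chart_inv i)}.
Proof.
move=> ip; have := @chart_inv_continuous _ _ _ A i.
by rewrite continuous_open_subspace; [apply; exact: mem_set|exact: img_open].
Qed.

End Charts.

(** * Representatives of isotopies in charts *)

Section LocalRep.
Context {R : realType} {m : nat} {M : pseudoPMetricType R}.
Context {A : smooth_atlas R m M}.
Local Notation I := (`[0%R, 1%R]%classic : set R).
Local Notation T := (R^o * 'rV[R]_m)%type.
Implicit Types (F G : R -> M -> M) (i j k : chart A).

(** The map g is F read from the chart i to the chart j. It is smooth on an open set that may reach
    beyond the times of [0, 1], so that two-sided derivatives are available at the end points;
    agreement with F is asked only for times in [0, 1]. *)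
Definition local_rep i j F (U : set T) (g : T -> 'rV[R]_m) :=
  [/\ open U, smooth_on U g & forall q, U q -> (coord i @` dom i) q.2 /\
    (I q.1 -> dom j (F q.1 (chart_inv i q.2)) /\
              coord j (F q.1 (chart_inv i q.2)) = g q)].

(** Continuity of F shrinks the domain of the smooth extension until F stays in [dom j] there. *)
Lemma local_repP i j F t x : isotopy_continuous F -> I t -> dom i x ->
    dom j (F t x) ->
  smooth_at ((I : set R^o) `*` setT)
      (fun q : R^o * 'rV[R]_m => coord j (F q.1 (chart_inv i q.2)))
      (t : R^o, coord i x) <->
  exists U g, local_rep i j F U g /\ U (t, coord i x).
Proof.
move=> cF It ix jFx; split; last first.
  move=> [U [g [[oU sg UE] Up]]]; exists U, g; split=> // q Uq [Iq _].
  by have [_ /(_ Iq)[]] := UE _ Uq.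
move=> [U [g [oU Up sg fg]]].
have nB : \forall q \near ((t : R^o), coord i x),
    [/\ U q, (coord i @` dom i) q.2 & I q.1 -> dom j (F q.1 (chart_inv i q.2))].
  have n1 : \forall q \near ((t : R^o), coord i x), U q.
    exact: open_nbhs_nbhs.
  have n2 : \forall q \near ((t : R^o), coord i x), (coord i @` dom i) q.2.
    apply: (@cvg_snd R^o 'rV[R]_m (nbhs (t : R^o)) (nbhs (coord i x))).
    exact: img_nbhs.
  have := (isotopy_continuousP F).1 cF t x It _ (dom_nbhs jFx).
  move=> [[P Q] [/= tP xQ] PQ].
  have n3 : \forall q \near ((t : R^o), coord i x), P q.1 /\ Q (chart_inv i q.2).
    apply: filterI.
      exact: (@cvg_fst R^o 'rV[R]_m (nbhs (t : R^o)) (nbhs (coord i x))).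
    have : \forall p \near coord i x, Q (chart_inv i p).
      apply: (@chart_inv_cont _ _ _ _ i (coord i x)); first by exists x.
      by rewrite coordK.
    exact: (@cvg_snd R^o 'rV[R]_m (nbhs (t : R^o)) (nbhs (coord i x))).
  near=> q; split.
  - by near: q.
  - by near: q.
  - have [Pq Qq] : P q.1 /\ Q (chart_inv i q.2) by near: q.
    exact: (PQ (q.1, chart_inv i q.2)).
move: nB; rewrite /prop_near1 nbhsE => -[B [oB Bp] BE].
exists B, g; split=> //; split=> //.
  by apply: smooth_on_sub sg => q /BE[].
move=> q /BE[Uq iq jq]; split=> // Iq; split; first exact: jq.
by apply: fg => //; split.
Unshelve. all: by end_near. Qed.

Lemma local_rep_at i j F U g t x : local_rep i j F U g ->
  U (t, coord i x) -> I t -> dom i x ->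
  dom j (F t x) /\ coord j (F t x) = g (t, coord i x).
Proof.
by move=> [_ _ UE] Up It ix; have [_ /(_ It)] := UE _ Up; rewrite /= coordK.
Qed.

Lemma local_rep_diff i j F U g q : local_rep i j F U g -> U q ->
  differentiable g q.
Proof. by move=> [_ sg _]; exact: smooth_on_differentiable. Qed.

(** Links the possibly one-sided velocity of [hamiltonian_of] to an ordinary derivative of g, to
    which the chain rule applies. *)
Lemma local_rep_time_derive i j F U g t x : local_rep i j F U g ->
    U (t, coord i x) -> I t -> dom i x ->
  (s - t)^-1 *: (coord j (F s x) - coord j (F t x)) @[s --> within I t^'] -->
  'D_(1, 0) g (t, coord i x).
Proof.
move=> rF Up It ix; have [oU _ UE] := rF.
have [_ Ft] := local_rep_at rF Up It ix.
have dg : derivable g (t, coord i x) (1, 0).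
  exact/diff_derivable/(local_rep_diff rF).
have E : \forall s \near within I t^',
    (s - t)^-1 *: (coord j (F s x) - coord j (F t x)) =
    (s - t)^-1 *: (g ((s - t) *: ((1, 0) : T) + (t : R^o, coord i x)) - g (t, coord i x)).
  rewrite near_withinE.
  have n1 : \forall s \near t, U (s, coord i x).
    have : \forall q \near ((t : R^o), coord i x), U q by exact: open_nbhs_nbhs.
    case=> -[P Q] [/= tP xQ] PQ; apply: filterS tP => s Ps.
    by apply: PQ; split=> //=; exact: nbhs_singleton.
  apply: filterS (nbhs_dnbhs n1) => s Us Is; congr (_ *: (_ - _)) => //.
  have [_ ->] := local_rep_at rF Us Is ix.
  congr (g (_, _)) => /=; last by rewrite scaler0 add0r.
  by rewrite [X in X + _]mulr1 subrK.
move=> B nB; rewrite /= nbhs_nearE.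
have /(_ _ nB) := dg => H.
have {}H := @within_I_shift _ t _ H.
suff : \forall s \near within I t^',
  B ((s - t)^-1 *: (coord j (F s x) - coord j (F t x))) by [].
by apply: filterS2 E H => s ->.
Qed.

Lemma local_rep_space_derive i j F U g t x v : local_rep i j F U g ->
    U (t, coord i x) -> I t -> dom i x ->
  'D_v (coord j \o F t \o chart_inv i) (coord i x) = 'D_(0, v) g (t, coord i x).
Proof.
move=> rF Up It ix; have [oU _ UE] := rF.
transitivity ('D_v (fun p => g ((t : R^o), p)) (coord i x)).
  apply: near_eq_derive.
  have : \forall q \near ((t : R^o), coord i x), U q by exact: open_nbhs_nbhs.
  case=> -[P Q] [/= tP xQ] PQ; apply: filterS xQ => p Qp.
  have Utp : U (t : R^o, p) by apply: PQ; split=> //=; exact: nbhs_singleton.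
  by have [_ /(_ It)[]] := UE _ Utp.
rewrite /derive; set a := (X in lim (X @ _) = _).
set b := (X in _ = lim (X @ _)); suff -> : a = b by [].
apply/funext => h; rewrite /a /b /=; congr (_ *: (g (_, _) - _)).
by rewrite /= scaler0 add0r.
Qed.

Lemma derive_split (g : T -> 'rV[R]_m) q a v : differentiable g q ->
  'D_(a, v) g q = a *: 'D_(1, 0) g q + 'D_(0, v) g q.
Proof.
move=> dg; rewrite !deriveE // -linearZ -linearD; congr ('d g q (_, _)).
  by rewrite /= addr0 [RHS]mulr1.
by rewrite /= scaler0 add0r.
Qed.

Lemma derive_compT (W : normedModType R) (h : W -> T) (g : T -> 'rV[R]_m) q w :
  differentiable h q -> differentiable g (h q) ->
  'D_w (g \o h) q = 'D_('D_w h q) g (h q).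
Proof.
move=> dh dg; rewrite deriveE; last exact: differentiable_comp.
by rewrite (diff_comp dh dg) (deriveE _ dg) (deriveE _ dh).
Qed.

Lemma derive_pair (a : T -> R^o) (g : T -> 'rV[R]_m) q w :
  differentiable a q -> differentiable g q ->
  'D_w (fun q => (a q, g q)) q = ('D_w a q, 'D_w g q).
Proof.
move=> da dg; rewrite !deriveE //; last exact: differentiable_pair.
by rewrite diff_pair.
Qed.

Lemma derive_fst (q w : T) : 'D_w (fst : T -> R^o) q = w.1.
Proof.
rewrite deriveE; last by apply: linear_differentiable => ?; exact: cvg_fst.
by rewrite diff_lin // => ?; exact: cvg_fst.
Qed.

Lemma derive_snd (q w : T) : 'D_w (snd : T -> 'rV[R]_m) q = w.2.
Proof.
rewrite deriveE; last by apply: linear_differentiable => ?; exact: cvg_snd.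
by rewrite diff_lin // => ?; exact: cvg_snd.
Qed.

Lemma open_preimage (U : set T) (U' : set T) (h : T -> T) :
  open U -> open U' -> (forall q, U q -> {for q, continuous h}) ->
  open (U `&` h @^-1` U').
Proof.
move=> oU oU' ch; rewrite openE => q [Uq Uhq]; rewrite /interior nbhs_nearE.
apply: filterI; first exact: open_nbhs_nbhs.
by apply: (ch q Uq); exact: open_nbhs_nbhs.
Qed.

Lemma local_rep_comp i k j F G U1 g1 U2 g2 :
  local_rep i k G U1 g1 -> local_rep k j F U2 g2 ->
  local_rep i j (fun t => F t \o G t)
    (U1 `&` (fun q => (q.1, g1 q)) @^-1` U2) (g2 \o (fun q => (q.1, g1 q))).
Proof.
move=> [oU1 s1 UE1] [oU2 s2 UE2].
have sh : smooth_on U1 (fun q : T => (q.1 : R^o, g1 q)).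
  by apply: smooth_on_pair => //; exact: smooth_on_fst.
have oU : open (U1 `&` (fun q : T => (q.1 : R^o, g1 q)) @^-1` U2).
  by apply: open_preimage => // q; exact: smooth_on_continuous.
split=> //.
  move=> K; apply: (Ck_comp (frame_prod m) (frame_rV m) oU oU2) => //.
  - by move=> q [].
  - by apply: Ck_sub (sh K) => q [].
move=> q [U1q U2q]; have [iq E1] := UE1 _ U1q; have [kq E2] := UE2 _ U2q.
split=> // Iq; have [kG Gq] := E1 Iq; have [] := E2 Iq.
by rewrite /= -Gq coordK.
Qed.

(** The chain rule behind the Hamiltonian of a product: the velocity of F_t o G_t is that of F plus
    the image under dF_t of that of G. *)
Lemma local_rep_comp_derive i k j F G U1 g1 U2 g2 q a v :
  local_rep i k G U1 g1 -> local_rep k j F U2 g2 ->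
  U1 q -> U2 (q.1, g1 q) ->
  'D_(a, v) (g2 \o (fun q => (q.1, g1 q))) q =
  a *: 'D_(1, 0) g2 (q.1, g1 q) + 'D_(0, 'D_(a, v) g1 q) g2 (q.1, g1 q).
Proof.
move=> r1 r2 U1q U2q.
have d1 := local_rep_diff r1 U1q; have d2 := local_rep_diff r2 U2q.
have df : differentiable (fst : T -> R^o) q.
  by apply: linear_differentiable => ?; exact: cvg_fst.
rewrite derive_compT //; last exact: differentiable_pair.
by rewrite derive_pair // derive_fst /= derive_split.
Qed.

Lemma local_rep_reparam i j F U g (z : R^o -> R^o) :
  smooth_on setT z -> (forall t, I t -> I (z t)) ->
  local_rep i j F U g ->
  local_rep i j (fun t => F (z t)) ((fun q => (z q.1, q.2)) @^-1` U)
    (g \o (fun q => (z q.1, q.2))).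
Proof.
move=> sz Iz [oU sg UE].
have sh : smooth_on setT (fun q : T => (z q.1 : R^o, q.2)).
  apply: smooth_on_pair; [exact: openT| |exact/smooth_on_snd/openT].
  move=> K; apply: (Ck_comp (@frame_R R) (@frame_R R) (U' := setT)) (sz K) => //.
  - exact: openT.
  - exact: openT.
  - exact: smooth_on_fst openT K.
have oU' : open ((fun q : T => (z q.1 : R^o, q.2)) @^-1` U).
  rewrite -[X in open X]setTI; apply: open_preimage => //; first exact: openT.
  by move=> q; exact: smooth_on_continuous.
split=> //.
  move=> K; apply: (Ck_comp (frame_prod m) (frame_rV m) oU' oU) => //.
  by apply: Ck_sub (sh K).
by move=> q Uq; have [iq E] := UE _ Uq; split=> // /Iz /E.
Qed.

Lemma local_rep_reparam_derive i j F U g (z : R^o -> R^o) q :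
  smooth_on setT z -> local_rep i j F U g -> U (z q.1, q.2) ->
  'D_(1, 0) (g \o (fun q => (z q.1, q.2))) q =
  'D_1 z q.1 *: 'D_(1, 0) g (z q.1, q.2).
Proof.
move=> sz rF Uq; have dg := local_rep_diff rF Uq.
have df : differentiable (fst : T -> R^o) q.
  by apply: linear_differentiable => ?; exact: cvg_fst.
have dz : differentiable (z : R^o -> R^o) q.1 by apply: smooth_on_differentiable sz _.
have dzf : differentiable (z \o fst : T -> R^o) q by exact: differentiable_comp.
have ds : differentiable (snd : T -> 'rV[R]_m) q.
  by apply: linear_differentiable => ?; exact: cvg_snd.
have E : 'D_(1, 0) (fun q : T => (z q.1 : R^o, q.2)) q = ('D_1 z q.1 : R^o, 0).
  by rewrite (derive_pair _ dzf ds) derive_snd.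
rewrite (derive_compT (h := fun q : T => (z q.1 : R^o, q.2)) _ _ dg); last first.
  exact: (differentiable_pair dzf ds).
by rewrite E (derive_split _ _ dg) derive0 addr0.
Qed.

End LocalRep.

(** * Products, inverses and time changes of strictly contact systems *)

Section ContactSystems.
Context {R : realType} {n : nat} {M : pseudoPMetricType R}.
Context {A : smooth_atlas R n.*2.+1 M}.
Variable alpha : one_form A.
Local Notation I := (`[0%R, 1%R]%classic : set R).
Local Notation T := (R^o * 'rV[R]_n.*2.+1)%type.
Local Notation smooth_path := (@isotopy_smooth R n M A).
Implicit Types (F G : R -> M -> M) (H K : R -> M -> R) (i j k : chart A).

Lemma pairingD (a u v : 'rV[R]_n.*2.+1) : pairing a (u + v) = pairing a u + pairing a v.
Proof.
by rewrite /pairing -big_split; apply: eq_bigr => k _; rewrite mxE mulrDr.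
Qed.

Lemma pairingZ (a v : 'rV[R]_n.*2.+1) (c : R) : pairing a (c *: v) = c * pairing a v.
Proof.
by rewrite /pairing mulr_sumr; apply: eq_bigr => k _; rewrite mxE mulrCA.
Qed.

Lemma pairing0 (a : 'rV[R]_n.*2.+1) : pairing a 0 = 0.
Proof. by rewrite -[0](scale0r (0 : 'rV[R]_n.*2.+1)) pairingZ mul0r. Qed.

Lemma isotopy_continuous_comp F G : isotopy_continuous F -> isotopy_continuous G ->
  isotopy_continuous (fun t => F t \o G t).
Proof.
move=> cF cG; apply/isotopy_continuousP => t x It B nB.
have [[P Q] [/= tP xQ] PQ] := (isotopy_continuousP F).1 cF t (G t x) It B nB.
have H1 := (isotopy_continuousP G).1 cG t x It Q xQ.
have H2 : \forall q \near (t, x), P q.1.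
  exact: (@cvg_fst _ _ (nbhs t) (nbhs x)).
by apply: filterS2 H1 H2 => q Qq Pq Iq; exact: (PQ (q.1, _) (conj Pq (Qq Iq)) Iq).
Qed.

Lemma isotopy_continuous_reparam F (z : R -> R) : continuous z ->
  (forall t, I t -> I (z t)) -> isotopy_continuous F ->
  isotopy_continuous (fun t => F (z t)).
Proof.
move=> cz Iz cF; apply/isotopy_continuousP => t x It B nB.
have [[P Q] [/= tP xQ] PQ] := (isotopy_continuousP F).1 cF (z t) x (Iz t It) B nB.
have H1 : \forall q \near (t, x), P (z q.1).
  exact: (@cvg_fst _ _ (nbhs t) (nbhs x) _ _ (cz t P tP)).
have H2 : \forall q \near (t, x), Q q.2.
  exact: (@cvg_snd _ _ (nbhs t) (nbhs x)).
by apply: filterS2 H1 H2 => q Pq Qq Iq; exact: (PQ (z q.1, q.2) (conj Pq Qq) (Iz _ Iq)).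
Qed.

Lemma smooth_path_rep F t x i j : smooth_path F -> I t -> dom i x ->
  dom j (F t x) -> exists U g, local_rep i j F U g /\ U (t, coord i x).
Proof.
move=> [cF sF] It ix jFx; apply/(local_repP (t := t)) => //.
exact: sF.
Qed.

Lemma smooth_path_intro F : isotopy_continuous F ->
  (forall t x i j, I t -> dom i x -> dom j (F t x) ->
    exists U g, local_rep i j F U g /\ U (t, coord i x)) -> smooth_path F.
Proof.
move=> cF rF; split=> // t x i j It ix jFx.
by apply/(local_repP (t := t)) => //; exact: rF.
Qed.

Lemma smooth_path_comp F G : smooth_path F -> smooth_path G ->
  smooth_path (fun t => F t \o G t).
Proof.
move=> sF sG; apply: smooth_path_intro.
  by apply: isotopy_continuous_comp; [exact: sF.1|exact: sG.1].
move=> t x i j It ix jFGx; have [k kGx] := dom_cover A (G t x).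
have [U1 [g1 [r1 U1p]]] := smooth_path_rep sG It ix kGx.
have [U2 [g2 [r2 U2p]]] := smooth_path_rep sF It kGx jFGx.
have [_ Gg] := local_rep_at r1 U1p It ix.
exists (U1 `&` (fun q => (q.1, g1 q)) @^-1` U2), (g2 \o (fun q => (q.1, g1 q))).
split; first exact: local_rep_comp r1 r2.
by split=> //=; rewrite -Gg.
Qed.

Lemma smooth_path_reparam F (z : R^o -> R^o) : smooth_on setT z ->
  (forall t, I t -> I (z t)) -> smooth_path F -> smooth_path (fun t => F (z t)).
Proof.
move=> sz Iz sF; apply: smooth_path_intro.
  apply: isotopy_continuous_reparam sF.1 => // t.
  exact: (smooth_on_continuous sz).
move=> t x i j It ix jFx.
have [U [g [r Up]]] := smooth_path_rep sF (Iz t It) ix jFx.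
exists ((fun q => (z q.1, q.2)) @^-1` U), (g \o (fun q => (z q.1, q.2))).
by split=> //; exact: local_rep_reparam.
Qed.

Lemma inverse_isotopies_sym F G : inverse_isotopies F G -> inverse_isotopies G F.
Proof. by move=> FG t It; have [] := FG t It. Qed.

Lemma inverse_isotopies_comp F F' G G' : inverse_isotopies F F' ->
  inverse_isotopies G G' ->
  inverse_isotopies (fun t => F t \o G t) (fun t => G' t \o F' t).
Proof.
move=> FF' GG' t It; have [a b] := FF' t It; have [c d] := GG' t It.
by split=> x /=; rewrite ?a ?c ?d ?b.
Qed.

Lemma smooth_isotopy_comp F G : smooth_isotopy (A := A) F ->
  smooth_isotopy (A := A) G -> smooth_isotopy (A := A) (fun t => F t \o G t).
Proof.
move=> [sF [F' [sF' FF']]] [sG [G' [sG' GG']]].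
split; first exact: smooth_path_comp.
exists (fun t => G' t \o F' t); split; first exact: smooth_path_comp.
exact: inverse_isotopies_comp.
Qed.

Lemma preserves_rep F t x i j U g v : preserves_form alpha (F t) ->
  I t -> dom i x -> local_rep i j F U g -> U (t, coord i x) ->
  pairing (coef alpha j (coord j (F t x))) ('D_(0, v) g (t, coord i x)) =
  pairing (coef alpha i (coord i x)) v.
Proof.
move=> pF It ix r Up; have [jF _] := local_rep_at r Up It ix.
by rewrite -(local_rep_space_derive v r Up It ix); exact: pF.
Qed.

Lemma preserves_comp F G t : I t -> smooth_path F -> smooth_path G ->
  preserves_form alpha (F t) -> preserves_form alpha (G t) ->
  preserves_form alpha (F t \o G t).
Proof.
move=> It sF sG pF pG x i j ix jFG v; have [k kGx] := dom_cover A (G t x).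
have [U1 [g1 [r1 U1p]]] := smooth_path_rep sG It ix kGx.
have [U2 [g2 [r2 U2p]]] := smooth_path_rep sF It kGx jFG.
have [_ Gg] := local_rep_at r1 U1p It ix.
have r := local_rep_comp r1 r2.
have U2p' : U2 (t, g1 (t, coord i x)) by rewrite -Gg.
rewrite (local_rep_space_derive (F := fun t => F t \o G t) v r) //=.
rewrite (local_rep_comp_derive _ _ r1 r2) //= scale0r add0r -Gg.
by rewrite (preserves_rep _ pF It kGx r2) // (preserves_rep _ pG It ix r1).
Qed.

(** Obtained by differentiating F_t(G_t(x)) = x in space and in time. *)
Lemma inverse_rep F G t x i k U1 g1 U2 g2 :
  inverse_isotopies F G -> I t -> dom i x ->
  local_rep i k G U1 g1 -> local_rep k i F U2 g2 ->
  U1 (t, coord i x) -> U2 (t, coord k (G t x)) ->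
  (forall v, 'D_(0, 'D_(0, v) g1 (t, coord i x)) g2 (t, coord k (G t x)) = v) /\
  'D_(1, 0) g2 (t, coord k (G t x)) +
  'D_(0, 'D_(1, 0) g1 (t, coord i x)) g2 (t, coord k (G t x)) = 0.
Proof.
move=> FG It ix r1 r2 U1p U2p; have [_ Gg] := local_rep_at r1 U1p It ix.
have r := local_rep_comp r1 r2.
have U2p' : U2 (t, g1 (t, coord i x)) by rewrite -Gg.
have FGx s y : I s -> F s (G s y) = y by move=> Is; exact: (FG s Is).2.
split=> [v|].
  have := local_rep_comp_derive 0 v r1 r2 U1p U2p'.
  rewrite scale0r add0r /= -Gg => <-.
  rewrite -(local_rep_space_derive (F := fun t => F t \o G t) v r) //.
  rewrite -[RHS](derive_id (coord i x) v); apply: near_eq_derive.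
  apply: filterS (img_nbhs ix) => p [y iy <-] /=.
  by rewrite FGx // coordK.
have := local_rep_comp_derive 1 0 r1 r2 U1p U2p'.
rewrite scale1r /= -Gg => <-.
have L := local_rep_time_derive (F := fun t => F t \o G t) r
  (conj U1p U2p') It ix.
have PF := proper_within_I It.
apply: (cvg_unique _ L); first exact: norm_hausdorff.
apply: cvg_near_cst; rewrite near_withinE; near=> s => Is /=.
by rewrite !FGx // subrr scaler0.
Unshelve. all: by end_near. Qed.

Lemma preserves_inverse F G t : I t -> smooth_path F -> smooth_path G ->
  inverse_isotopies F G -> preserves_form alpha (F t) ->
  preserves_form alpha (G t).
Proof.
move=> It sF sG FG pF x i k ix kGx v.
have iFG : dom i (F t (G t x)) by rewrite (FG t It).2.
have [U1 [g1 [r1 U1p]]] := smooth_path_rep sG It ix kGx.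
have [U2 [g2 [r2 U2p]]] := smooth_path_rep sF It kGx iFG.
have [E _] := inverse_rep FG It ix r1 r2 U1p U2p.
rewrite (local_rep_space_derive v r1) //.
by rewrite -(preserves_rep _ pF It kGx r2 U2p) E (FG t It).2.
Qed.

(** Uniqueness of limits identifies the velocity given by [hamiltonian_of] with the time derivative
    of any representative. *)
Lemma hamiltonian_rep F H t x i j U g : hamiltonian_of alpha F H ->
  I t -> dom i x -> local_rep i j F U g -> U (t, coord i x) ->
  H t (F t x) =
  pairing (coef alpha j (coord j (F t x))) ('D_(1, 0) g (t, coord i x)).
Proof.
move=> hF It ix r Up; have [jF _] := local_rep_at r Up It ix.
have [v cv ->] := hF t x j It jF.
have L := local_rep_time_derive r Up It ix.
have PF := proper_within_I It.
congr pairing; apply: (cvg_unique _ cv L); exact: norm_hausdorff.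
Qed.

Lemma hamiltonian_intro F H :
  (forall t x j, I t -> dom j (F t x) -> exists i U g,
    [/\ dom i x, local_rep i j F U g, U (t, coord i x) &
    H t (F t x) =
    pairing (coef alpha j (coord j (F t x))) ('D_(1, 0) g (t, coord i x))]) ->
  hamiltonian_of alpha F H.
Proof.
move=> E t x j It jF; have [i [U [g [ix r Up ->]]]] := E t x j It jF.
exists ('D_(1, 0) g (t, coord i x)) => //.
exact: (local_rep_time_derive r Up It ix).
Qed.

(** In the velocity of F_t o G_t, the term dF_t(Y) with Y the velocity of G has alpha(dF_t(Y)) =
    alpha(Y), because F_t preserves alpha. It therefore contributes K_t at G_t(x), the preimage
    under F_t of the point reached. *)
Lemma contact_system_comp F F' G H K :
  smooth_contact_system alpha F H -> smooth_contact_system alpha G K ->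
  inverse_isotopies F F' ->
  smooth_contact_system alpha (fun t => F t \o G t)
    (fun t x => H t x + K t (F' t x)).
Proof.
move=> [[iF F0 pF] hF] [[iG G0 pG] hG] FF'; split.
  split; first exact: smooth_isotopy_comp.
    by rewrite F0 G0.
  move=> t It; apply: preserves_comp => //; [exact: iF.1|exact: iG.1|exact: pF|exact: pG].
apply: hamiltonian_intro => t x j It jFG.
have [i ix] := dom_cover A x; have [k kGx] := dom_cover A (G t x).
have [U1 [g1 [r1 U1p]]] := smooth_path_rep iG.1 It ix kGx.
have [U2 [g2 [r2 U2p]]] := smooth_path_rep iF.1 It kGx jFG.
have [_ Gg] := local_rep_at r1 U1p It ix.
have r := local_rep_comp r1 r2.
have U2p' : U2 (t, g1 (t, coord i x)) by rewrite -Gg.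
exists i; do 2 eexists; split; [exact: ix|exact: r|by []|].
have E1 := hamiltonian_rep hF It kGx r2 U2p.
have E2 := hamiltonian_rep hG It ix r1 U1p.
rewrite (local_rep_comp_derive _ _ r1 r2) //= scale1r pairingD -Gg.
rewrite E1 (FF' t It).1 E2; congr (_ + _).
apply/esym; exact: (preserves_rep _ (pF t It) It kGx r2 U2p).
Qed.

(** Apply alpha to the time derivative of F_t(F'_t(x)) = x: the velocity of F gives H_t(x), and by
    invariance of alpha the other term gives the Hamiltonian of F' at F'_t(x). *)
Lemma contact_system_inverse F F' H : smooth_contact_system alpha F H ->
  smooth_path F' -> inverse_isotopies F F' ->
  smooth_contact_system alpha F' (fun t x => - H t (F t x)).
Proof.
move=> [[iF F0 pF] hF] sF' FF'.
have I0 : I 0 by rewrite /= in_itv /= lexx ler01.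
split.
  split.
  - split=> //; exists F; split; first exact: iF.1.
    exact: inverse_isotopies_sym.
  - apply/funext => x /=; rewrite -[in RHS](proj2 (FF' 0 I0) x).
    by rewrite F0.
  - move=> t It; apply: preserves_inverse FF' (pF t It) => //; exact: iF.1.
apply: hamiltonian_intro => t x k It kF'x.
have [i ix] := dom_cover A x.
have iFF : dom i (F t (F' t x)) by rewrite (FF' t It).2.
have [U1 [g1 [r1 U1p]]] := smooth_path_rep sF' It ix kF'x.
have [U2 [g2 [r2 U2p]]] := smooth_path_rep iF.1 It kF'x iFF.
have [_ E] := inverse_rep FF' It ix r1 r2 U1p U2p.
exists i, U1, g1; split=> //.
have E1 := hamiltonian_rep hF It kF'x r2 U2p.
have E2 := preserves_rep ('D_(1, 0) g1 (t, coord i x)) (pF t It) It kF'x r2 U2p.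
pose a := coef alpha i (coord i (F t (F' t x))).
have E3 := etrans (esym (pairingD a _ _)) (etrans (congr1 (pairing a) E) (pairing0 a)).
by apply/eqP; rewrite E1 -E2 eq_sym -addr_eq0 addrC; apply/eqP.
Qed.

Lemma contact_system_reparam F H (z : R^o -> R^o) :
  smooth_contact_system alpha F H -> smooth_on setT z ->
  (forall t, I t -> I (z t)) -> z 0 = 0 ->
  smooth_contact_system alpha (fun t => F (z t))
    (fun t x => 'D_1 z t * H (z t) x).
Proof.
move=> [[[sF [F' [sF' FF']]] F0 pF] hF] sz Iz z0; split.
  split.
  - split; first exact: smooth_path_reparam.
    exists (fun t => F' (z t)); split; first exact: smooth_path_reparam.
    by move=> t /Iz; exact: FF'.
  - by rewrite z0.
  - by move=> t /Iz; exact: pF.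
apply: hamiltonian_intro => t x j It jF.
have [i ix] := dom_cover A x.
have [U [g [r Up]]] := smooth_path_rep sF (Iz t It) ix jF.
exists i, ((fun q => (z q.1, q.2)) @^-1` U), (g \o (fun q => (z q.1, q.2))).
split=> //; first exact: local_rep_reparam.
rewrite (local_rep_reparam_derive sz r) //= pairingZ.
by rewrite (hamiltonian_rep hF (Iz t It) ix r Up).
Qed.

Lemma cvg_pairing (Y : Type) (f g : Y -> 'rV[R]_n.*2.+1) (l k : 'rV[R]_n.*2.+1)
    (B : set_system Y) : Filter B ->
  f x @[x --> B] --> l -> g x @[x --> B] --> k ->
  pairing (f x) (g x) @[x --> B] --> pairing l k.
Proof.
move=> FB fl gk; apply: cvg_big => [|c _]; first exact: add_continuous.
apply: cvgM.
- exact: (@cvg_comp _ _ _ f (rV_crd c) _ _ _ fl (@rV_crd_continuous R _ c l)).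
- exact: (@cvg_comp _ _ _ g (rV_crd c) _ _ _ gk (@rV_crd_continuous R _ c k)).
Qed.

(** In charts H_t o F_t is the pairing of the coefficients of alpha with the time derivative of a
    representative, hence continuous; composing with the continuous inverse isotopy recovers H. *)
Lemma hamiltonian_continuous F H : smooth_contact_system alpha F H ->
  {within I `*` setT, continuous (fun q : R * M => H q.1 q.2)}.
Proof.
move=> [[[sF [F' [sF' FF']]] F0 pF] hF].
have cHF t x : I t -> forall B, nbhs (H t (F t x)) B ->
    \forall q \near (t, x), I q.1 -> B (H q.1 (F q.1 q.2)).
  move=> It; have [i ix] := dom_cover A x; have [j jF] := dom_cover A (F t x).
  have [U [g [r Up]]] := smooth_path_rep sF It ix jF.
  have [oU sg _] := r; have [_ Fg] := local_rep_at r Up It ix.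
  pose h (q : T) := pairing (coef alpha j (g q)) ('D_(1, 0) g q).
  have ch : {for (t, coord i x), continuous (h : T -> R)}.
    apply: cvg_pairing.
      apply: continuous_comp; first exact: (smooth_on_continuous sg).
      rewrite -Fg; apply: (smooth_on_continuous (coef_smooth alpha j)).
      by exists (F t x).
    have := smooth_on_continuous (smooth_on_derive ((1, 0) : T) sg) Up.
    exact.
  have cc (P : set T) : nbhs ((t : R^o), coord i x) P ->
      nbhs (t, x) (fun q => P (q.1, coord i q.2)).
    case=> -[P1 P2] [/= tP xP] PP; exists (P1, coord i @^-1` P2).
      by split=> //=; exact: coord_cont ix _ xP.
    by move=> q [/= a b]; exact: (PP (q.1, coord i q.2)).
  have n1 : \forall q \near (t, x), U (q.1, coord i q.2).
    by apply: cc; exact: open_nbhs_nbhs.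
  have n2 : \forall q \near (t, x), dom i q.2.
    by apply: (@cvg_snd _ _ (nbhs t) (nbhs x)); exact: dom_nbhs.
  move=> B; rewrite (hamiltonian_rep hF It ix r Up) Fg => nB.
  have n3 := cc _ (ch B nB).
  near=> q => Iq.
  have iq : dom i q.2 by near: q.
  have Uq : U (q.1, coord i q.2) by near: q.
  rewrite (hamiltonian_rep hF Iq iq r Uq).
  have [_ ->] := local_rep_at r Uq Iq iq.
  by near: q.
apply/subspace_continuousP => -[t x] [/= It _] B nB.
have {}nB : nbhs (H t (F t (F' t x))) B by rewrite (FF' t It).2.
have [[P Q] [/= tP xQ] PQ] := cHF t (F' t x) It B nB.
have H1 := (isotopy_continuousP F').1 sF'.1 t x It Q xQ.
have H2 : \forall q \near (t, x), P q.1.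
  exact: (@cvg_fst _ _ (nbhs t) (nbhs x)).
rewrite /= /fmap /= /within /=.
apply: filterS2 H1 H2 => q Qq Pq [Iq _].
have := PQ (q.1, F' q.1 q.2) (conj Pq (Qq Iq)) Iq.
by rewrite /= (FF' _ Iq).2.
Unshelve. all: by end_near. Qed.

End ContactSystems.

(** * Polynomial approximation and change of time *)

Lemma compact_unif_continuous (R : realType) (T Y : pseudoMetricType R)
    (K : set T) (f : T -> Y) : compact K -> {within K, continuous f} ->
  forall e, 0 < e -> exists2 d, 0 < d &
    forall x y, K x -> K y -> ball x d y -> ball (f x) e (f y).
Proof.
move=> /compact_near_coveringP cK /subspace_continuousP cf e e0.
have e20 : 0 < e / 2 by rewrite divr_gt0.
pose P (d : R) x := K x -> forall y, K y -> ball x d y -> ball (f x) e (f y).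
have : \forall d \near 0^'+, K `<=` P d.
  apply: cK => x Kx.
  have := cf x Kx _ (nbhsx_ballx (f x) _ e20).
  rewrite /fmap /= /within /= => /nbhs_ballP[r /= r0 rf].
  have r20 : 0 < r / 2 by rewrite divr_gt0.
  exists (ball x (r / 2), [set d | d < r / 2]).
    split=> /=; first exact: nbhsx_ballx.
    exact: nbhs_right_lt.
  move=> [x' d] [/= xx' dr] Kx' y Ky x'y.
  rewrite (splitr e); apply: ball_triangle (_ : ball (f x) _ _).
    apply: ball_sym; apply: rf => //; apply: le_ball xx'.
    by lra.
  apply: rf => //; rewrite (splitr r); apply: ball_triangle xx' _.
  by apply: le_ball x'y; exact: ltW.
move=> H; have [d [d0 Hd]] : exists d : R, 0 < d /\ K `<=` P d.
  near (0 : R)^'+ => d; exists d; split; first by near: d; exact: nbhs_right_gt.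
  by near: d.
by exists d => // x y Kx Ky; exact: (Hd x Kx Kx y Ky).
Unshelve. all: by end_near. Qed.

(** * Bernstein polynomials and polynomial majorants *)

Section Bernstein.
Context {R : realType}.
Implicit Types (g h : nat -> R) (x : R) (N k : nat).

(* The Bernstein operator, through the Pascal recursion for the binomial
   weights: the value at x is the mean of g over a binomial law B(N, x). *)
Fixpoint bernstein N g : {poly R} :=
  match N with
  | 0 => (g 0%N)%:P
  | N'.+1 => 'X * bernstein N' (g \o S) + (1 - 'X) * bernstein N' g
  end.

Lemma bernsteinS N g x : (bernstein N.+1 g).[x] =
  x * (bernstein N (g \o S)).[x] + (1 - x) * (bernstein N g).[x].
Proof. by rewrite /= !hornerE. Qed.

Lemma bernsteinD N g h x : (bernstein N (g \+ h)).[x] =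
  (bernstein N g).[x] + (bernstein N h).[x].
Proof.
elim: N g h => [|N IH] g h; first by rewrite /= !hornerE.
rewrite !bernsteinS (IH g h) -[(_ \+ _) \o S]/((g \o S) \+ (h \o S)) IH; ring.
Qed.

Lemma bernsteinZ N g c x : (bernstein N (fun k => c * g k)).[x] =
  c * (bernstein N g).[x].
Proof.
elim: N g => [|N IH] g; first by rewrite /= !hornerE.
by rewrite !bernsteinS (IH g) (IH (g \o S)); ring.
Qed.

Lemma bernstein_cst N c x : (bernstein N (fun=> c)).[x] = c.
Proof.
elim: N => [|N IH]; first by rewrite /= !hornerE.
by rewrite bernsteinS -[_ \o S]/(fun=> c) IH; ring.
Qed.

Lemma bernstein_id N x : (bernstein N (fun k => k%:R)).[x] = N%:R * x.
Proof.
elim: N => [|N IH]; first by rewrite /= !hornerE ?mul0r.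
rewrite bernsteinS (_ : _ \o S = (fun k => k%:R) \+ fun=> 1); last first.
  by apply/funext => k /=; rewrite -natr1.
by rewrite bernsteinD bernstein_cst IH -natr1; ring.
Qed.

Lemma bernstein_sqr N x : (bernstein N (fun k => k%:R ^+ 2)).[x] =
  N%:R * x * (1 - x) + (N%:R * x) ^+ 2.
Proof.
elim: N => [|N IH]; first by rewrite /= !hornerE; ring.
rewrite bernsteinS (_ : _ \o S = (fun k => k%:R ^+ 2) \+
    ((fun k => 2 * k%:R) \+ fun=> 1)); last first.
  by apply/funext => k /=; rewrite -natr1; ring.
rewrite !bernsteinD bernsteinZ bernstein_id bernstein_cst IH -natr1; ring.
Qed.

Lemma bernstein_variance N x :
  (bernstein N (fun k => (k%:R - N%:R * x) ^+ 2)).[x] = N%:R * x * (1 - x).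
Proof.
rewrite (_ : (fun k => _) = (fun k => k%:R ^+ 2) \+
    ((fun k => (- (2 * (N%:R * x))) * k%:R) \+ fun=> (N%:R * x) ^+ 2)); last first.
  by apply/funext => k /=; ring.
by rewrite !bernsteinD bernsteinZ bernstein_id bernstein_cst bernstein_sqr; ring.
Qed.

Lemma bernstein_le N g h x : 0 <= x <= 1 -> (forall k, (k <= N)%N -> g k <= h k) ->
  (bernstein N g).[x] <= (bernstein N h).[x].
Proof.
move=> /andP[x0 x1]; elim: N g h => [|N IH] g h gh.
  by rewrite /= !hornerE; exact: gh.
rewrite !bernsteinS; apply: lerD; apply: ler_wpM2l; rewrite ?subr_ge0 //.
  by apply: IH => k kN; exact: gh.
by apply: IH => k kN; apply: gh; exact: leqW.
Qed.

Lemma itv01_unif_continuous (f : R -> R) :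
  {within `[0, 1], continuous f} -> forall e, 0 < e -> exists2 d, 0 < d &
  forall x y, x \in `[0, 1] -> y \in `[0, 1] -> `|x - y| < d -> `|f x - f y| < e.
Proof.
move=> cf e e0.
have [d d0 fd] := compact_unif_continuous (@segment_compact _ 0 1) cf e0.
by exists d => // x y Ix Iy; exact: fd.
Qed.

Lemma itv01_bounded (f : R -> R) : {within `[0, 1], continuous f} ->
  exists2 B, 0 <= B & forall x, x \in `[0, 1] -> `|f x| <= B.
Proof.
move=> cf; have [c _ cmax] := EVT_max (ler01) cf.
have [d _ dmin] := EVT_min (ler01) cf.
exists (Num.max `|f c| `|f d|); first by rewrite le_max normr_ge0.
move=> x Ix; rewrite ler_norml; apply/andP; split.
  rewrite lerNl; apply: (@le_trans _ _ (- f d)); first by rewrite lerN2 dmin.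
  by rewrite le_max -(normrN (f d)) ler_norm orbT.
by apply: le_trans (cmax x Ix) _; rewrite le_max ler_norm.
Qed.

(** Bernstein's argument. At a sample point y = k / N within d of x, f differs from f(x) by at most
    e / 2; elsewhere the difference is at most 2 B <= C (y - x)^2. The binomial mean of (y - x)^2 is
    x (1 - x) / N <= 1 / N, and N is such that C / N <= e / 2. *)
Lemma weierstrass (f : R -> R) e : {within `[0, 1], continuous f} -> 0 < e ->
  exists p : {poly R}, forall x, x \in `[0, 1] -> `|f x - p.[x]| <= e.
Proof.
move=> cf e0; have [B B0 fB] := itv01_bounded cf.
have e20 : 0 < e / 2 by lra.
have [d d0 fd] := itv01_unif_continuous cf e20.
pose C := 2 * B / d ^+ 2.
have C0 : 0 <= C by rewrite divr_ge0 ?sqr_ge0 ?mulr_ge0.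
pose N := (Num.truncn (2 * C / e)).+1.
have N0 : 0 < N%:R :> R by rewrite ltr0n.
have NC : C / N%:R <= e / 2.
  have : 2 * C / e < N%:R by exact: truncnS_gt.
  rewrite ltr_pdivrMr // => H.
  by rewrite ler_pdivrMr //; lra.
exists (bernstein N (fun k => f (k%:R / N%:R))) => x Ix.
have x01 : 0 <= x <= 1 by move: Ix; rewrite in_itv.
pose h k := e / 2 + C * (k%:R / N%:R - x) ^+ 2.
have Ik k : (k <= N)%N -> k%:R / N%:R \in `[0 : R, 1].
  move=> kN; rewrite in_itv /= divr_ge0 ?ler0n //=.
  by rewrite ler_pdivrMr // mul1r ler_nat.
have key k : (k <= N)%N -> `|f (k%:R / N%:R) - f x| <= h k.
  move=> /Ik Iy; set y := k%:R / N%:R in Iy *; rewrite /h -/y.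
  have [xy|xy] := ltP `|y - x| d.
    apply: le_trans (ltW (fd _ _ Iy Ix xy)) _.
    by rewrite lerDl mulr_ge0 // sqr_ge0.
  apply: (@le_trans _ _ (2 * B)).
    by apply: le_trans (ler_normB _ _) _; have := fB _ Iy; have := fB _ Ix; lra.
  apply: (@le_trans _ _ (C * (y - x) ^+ 2)); last by rewrite lerDr ltW.
  have d2 : d ^+ 2 <= (y - x) ^+ 2.
    by rewrite -(real_normK (num_real (y - x))) lerXn2r // nnegrE ?ltW.
  apply: le_trans (ler_wpM2l C0 d2).
  by rewrite /C divfK // expf_neq0 // gt_eqF.
have Eh : (bernstein N h).[x] <= e.
  rewrite (_ : h = (fun=> e / 2) \+ (fun k => (C / N%:R ^+ 2) * (k%:R - N%:R * x) ^+ 2)).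
    rewrite bernsteinD bernstein_cst bernsteinZ bernstein_variance.
    have -> : C / N%:R ^+ 2 * (N%:R * x * (1 - x)) = C / N%:R * (x * (1 - x)).
      by field; rewrite gt_eqF.
    have : C / N%:R * (x * (1 - x)) <= C / N%:R * 1.
      by apply: ler_wpM2l; [rewrite divr_ge0 // ltW|nra].
    lra.
  by apply/funext => k; rewrite /h /=; field; rewrite gt_eqF.
have Ef : (bernstein N (fun k => f (k%:R / N%:R) - f x)).[x] =
    (bernstein N (fun k => f (k%:R / N%:R))).[x] - f x.
  rewrite (_ : (fun k => _) = (fun k => f (k%:R / N%:R)) \+ fun=> - f x) //.
  by rewrite bernsteinD bernstein_cst.
rewrite distrC -Ef; apply: le_trans Eh; rewrite ler_norml; apply/andP; split.
  rewrite lerNl -mulN1r -bernsteinZ; apply: bernstein_le => // k kN.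
  by have := key k kN; rewrite ler_norml => /andP[]; lra.
by apply: bernstein_le => // k kN; apply: le_trans (ler_norm _) (key k kN).
Qed.

(* Squaring an approximation of the square root keeps the majorant positive
   on the whole line. *)
Lemma poly_majorant (u : R -> R) e : {within `[0, 1], continuous u} -> 0 < e ->
  (forall x, x \in `[0, 1] -> 0 <= u x) ->
  exists (w : {poly R}) d, [/\ 0 < d, forall x, d <= w.[x] &
    forall x, x \in `[0, 1] -> u x <= w.[x] <= u x + e].
Proof.
move=> cu e0 u0; pose f x := Num.sqrt (u x).
have cf : {within `[0, 1], continuous f}.
  by move=> x; apply: continuous_comp (cu x) _; exact: sqrt_continuous.
have [B B0 fB] := itv01_bounded cf.
(* As r <= 1, an r-approximation p of f has |p^2 - u| <= r (2 B + 1) <= e / 2; adding e / 2 to p^2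
   gives a majorant exceeding u by at most e. *)
pose r := Num.min 1 (e / (2 * (2 * B + 1))).
have r0 : 0 < r by rewrite lt_min ltr01 divr_gt0 //; lra.
have r1 : r <= 1 by rewrite ge_min lexx.
have re : r * (2 * B + 1) <= e / 2.
  have : r <= e / (2 * (2 * B + 1)) by rewrite ge_min lexx orbT.
  rewrite ler_pdivlMr; last by lra.
  by lra.
have [p fp] := weierstrass cf r0.
exists (p * p + (e / 2)%:P), (e / 2); split; first by lra.
  by move=> x; rewrite !hornerE lerDr -expr2 sqr_ge0.
move=> x Ix; rewrite !hornerE.
have uE : u x = f x * f x by rewrite -expr2 sqr_sqrtr // u0.
have := fp x Ix; have := fB x Ix; rewrite !ler_norml => /andP[f1 f2] /andP[p1 p2].
have f0 : 0 <= f x by exact: sqrtr_ge0.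
rewrite uE; set a := f x in f0 f1 f2 p1 p2 *; set b := p.[x] in p1 p2 *.
have H : `|b * b - a * a| <= e / 2.
  have -> : b * b - a * a = (b - a) * (b + a) by ring.
  rewrite normrM; apply: le_trans re; apply: ler_pM => //.
    by rewrite ler_norml; apply/andP; split; lra.
  by rewrite ler_norml; apply/andP; split; lra.
by move: H; rewrite ler_norml => /andP[]; lra.
Qed.

(** The constant coefficient is a quotient by 0, which is 0 by convention, so this is the primitive
    that vanishes at 0. *)
Definition prim (p : {poly R}) : {poly R} :=
  \poly_(i < (size p).+1) (p`_i.-1 / i%:R).

Lemma deriv_prim (p : {poly R}) : (prim p)^`() = p.
Proof.
apply/polyP => i; rewrite coef_deriv coef_poly ltnS.
case: ltnP => [ip|pi] /=; last by rewrite mul0rn nth_default.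
by rewrite -[LHS]mulr_natr divfK // pnatr_eq0.
Qed.

Lemma prim0 (p : {poly R}) : (prim p).[0] = 0.
Proof. by rewrite horner_coef0 coef_poly /= invr0 mulr0. Qed.

End Bernstein.

(** * Smooth change of time *)

Section Reparametrization.
Context {R : realType}.

Lemma Ck_horner k (U : set R^o) (p : {poly R}) : open U ->
  Ck k U (horner p : R^o -> R^o).
Proof.
move=> oU; elim: k p => [|k IH] p /=.
  by move=> x _; exact: continuous_horner.
have dp x : differentiable (horner p : R^o -> R^o) x.
  exact/derivable1_diffP/derivable_horner.
split=> [x _|v]; first exact: dp.
rewrite (_ : 'D_v _ = (cst v : R^o -> R^o) \* horner p^`()).
  by apply: CkM => //; exact: Ck_cst.
apply/funext => x /=.
rewrite deriveE // -[v in LHS]mulr1 -[v * 1]/(v *: (1 : R^o)) linearZ /= -deriveE //.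
by rewrite derivE derive1E.
Qed.

Lemma Ck_inv k (U : set R^o) (p : {poly R}) : open U -> (forall x, p.[x] != 0) ->
  Ck k U (fun x : R^o => (p.[x])^-1 : R^o).
Proof.
move=> oU p0.
have dp x v : derivable (horner p : R^o -> R^o) x v.
  by apply: diff_derivable; exact/derivable1_diffP/derivable_horner.
elim: k => [|k IH] /=.
  by move=> x _; apply: cvgV => //; exact: continuous_horner.
split=> [x _|v].
  by apply: differentiableV => //; exact/derivable1_diffP/derivable_horner.
pose q x : R^o := (p.[x])^-1.
rewrite (_ : 'D_v _ = (cst (-1) : R^o -> R^o) \* ((q \* q) \* 'D_v (horner p : R^o -> R^o))).
  apply: CkM => //; first exact: Ck_cst.
  by apply: CkM => //; [exact: CkM|exact: (Ck_horner k.+1 p oU).2].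
apply/funext => x /=; rewrite [LHS]deriveV //.
by rewrite /q mulN1r scaleNr expr2 invfM.
Qed.

(** The primitive has slope at least d on the whole line, so it is increasing and onto; its inverse
    is defined and differentiable everywhere, without end points to treat apart. *)
Lemma poly_inverse (w : {poly R}) d : 0 < d -> (forall x, d <= w.[x]) ->
  exists s : R -> R, [/\ forall y, (prim w).[s y] = y,
    forall x, s (prim w).[x] = x,
    {homo s : x y / x <= y} & forall y, is_derive y (1 : R) s (w.[s y])^-1].
Proof.
move=> d0 dw; pose T := prim w.
have dT (x : R) : is_derive x (1 : R) (horner T) w.[x].
  by rewrite -[in w.[x]](deriv_prim w); exact: is_derive_poly.
have cT : continuous (horner T) by exact: continuous_horner.
have slope x y : x <= y -> d * (y - x) <= T.[y] - T.[x].
  move=> xy; have [] := @MVT_segment R (horner T) (horner w) x y xy.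
  - by apply: continuous_subspaceT => z; exact: cT.
  - by move=> c _ ->; rewrite ler_wpM2r // subr_ge0.
have mono x y : x < y -> T.[x] < T.[y].
  move=> xy; rewrite -subr_gt0; apply: lt_le_trans (slope _ _ (ltW xy)).
  by rewrite mulr_gt0 // subr_gt0.
have inj x y : T.[x] = T.[y] -> x = y.
  move=> E; have [/mono|/mono|//] := ltgtP x y; by rewrite E ltxx.
have T0 : T.[0] = 0 by exact: prim0.
have surj y : exists x, T.[x] = y.
  (* By the slope bound the primitive is at least |y| at b and at most - |y| at - b. *)
  pose b := `|y| / d.
  have b0 : 0 <= b by rewrite divr_ge0 // ltW.
  have yT : T.[- b] <= y <= T.[b].
    have := slope 0 b b0; have nb : - b <= 0 by rewrite oppr_le0.
    have := slope (- b) 0 nb; rewrite T0 !subr0 !sub0r opprK.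
    have -> : d * b = `|y| by rewrite /b mulrC divfK // gt_eqF.
    move=> h1 h2; have := ler_norm y; have := ler_norm (- y); rewrite normrN => h3 h4.
    by apply/andP; split; lra.
  have bb : - b <= b by lra.
  have [] := @IVT R (horner T) (- b) b y bb.
  - by apply: continuous_subspaceT => z; exact: cT.
  - have /andP[y1 y2] := yT.
    by rewrite ge_min y1 le_max y2 orbT.
  - by move=> c _ <-; exists c.
pose s y := sval (cid (surj y)).
have sE y : T.[s y] = y by rewrite /s; case: cid.
have sK x : s T.[x] = x by apply: inj; rewrite sE.
exists s; split=> //.
  move=> x y xy; rewrite leNgt; apply/negP => /mono; rewrite !sE.
  by rewrite ltNge xy.
move=> y; rewrite -{1}(sE y).
apply: (@is_derive_inverse R (horner T)).
- by near=> x; exact: sK.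
- by near=> x; exact: cT.
- by rewrite gt_eqF // (lt_le_trans d0).
Unshelve. all: by end_near. Qed.

Local Notation I := (`[0%R, 1%R]%classic : set R).

(* If tau is a primitive of a majorant w of u with tau 0 = 0 and W = tau 1,
   then z = tau^-1 (W t) has z' u(z) = W u(z) / w(z) <= W. *)
Lemma reparametrization (u : R -> R) e : {within I, continuous u} ->
    (forall t, I t -> 0 <= u t) -> 0 < e ->
  exists z : R^o -> R^o,
  [/\ smooth_on setT z, forall t, I t -> I (z t), z 0 = 0, z 1 = 1 &
    forall t, I t -> 0 <= 'D_1 z t /\
      (('D_1 z t * u (z t))%:E <=
       \int[@lebesgue_measure R]_(s in I) (u s)%:E + e%:E)%E].
Proof.
move=> cu u0 e0.
have u0' t : t \in `[0, 1] -> 0 <= u t by exact: u0.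
have [w [d [d0 dw wu]]] := poly_majorant cu e0 u0'.
have [s [sE sK s_homo ds]] := poly_inverse d0 dw.
pose W := (prim w).[1].
have w0 x : 0 < w.[x] by exact: lt_le_trans (dw x).
have WE : (W%:E = \int[@lebesgue_measure R]_(s in I) (w.[s])%:E)%E.
  rewrite (@continuous_FTC2 R (horner w) (horner (prim w)) 0 1) //.
  - by rewrite prim0 sube0.
  - by apply: continuous_subspaceT => z; exact: continuous_horner.
  - split.
    + by move=> x _; exact: derivable_horner.
    + by apply: cvg_at_right_filter; exact: continuous_horner.
    + by apply: cvg_at_left_filter; exact: continuous_horner.
  - by move=> x _; rewrite -derivE deriv_prim.
have mu : measurable_fun I u.
  by apply: subspace_continuous_measurable_fun.
have Wle : (W%:E <= \int[@lebesgue_measure R]_(s in I) (u s)%:E + e%:E)%E.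
  rewrite WE.
  have -> : (\int[@lebesgue_measure R]_(s in I) (u s)%:E + e%:E =
     \int[@lebesgue_measure R]_(s in I) ((u s)%:E + (cst e%:E) s))%E.
    rewrite ge0_integralD //.
    - rewrite integral_cst //= lebesgue_measure_itv /= lte01 oppr0 adde0 mule1 //.
    - exact/measurable_EFinP.
    - by move=> x _; rewrite lee_fin ltW.
  apply: ge0_le_integral => //.
  - by move=> x _; rewrite lee_fin ltW.
  - apply/measurable_EFinP; apply: subspace_continuous_measurable_fun => //.
    by apply: continuous_subspaceT => z; exact: continuous_horner.
  - by apply: emeasurable_funD => //; exact/measurable_EFinP.
  - by move=> x Ix; rewrite -EFinD lee_fin; have /andP[] := wu x Ix.
have W0 : 0 < W.
  by rewrite -(prim0 w) ltNge; apply/negP => /s_homo; rewrite !sK ler10.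
pose z (t : R^o) : R^o := s (W * t).
have dz (t : R^o) : is_derive t (1 : R^o) z (W / w.[z t]).
  have dW : is_derive t (1 : R^o) (fun t : R^o => W * t : R^o) W.
    have -> : (fun t : R^o => W * t : R^o) = W *: (id : R^o -> R^o) by [].
    by rewrite -[X in is_derive _ _ _ X]mulr1; exact: is_deriveZ.
  have := ds (W * t); move=> dsW.
  have -> : W / w.[z t] = (w.[s (W * t)])^-1 * W by rewrite mulrC.
  exact: is_derive1_comp.
have dfz (t : R^o) : differentiable z t.
  by apply/derivable1_diffP; exact: ex_derive.
(* As z' = W / w(z), z' is of class C^k as soon as z is: smoothness follows by induction. *)
have smz : smooth_on setT z.
  elim=> [|k IH] /=.
    by move=> x _; exact: differentiable_continuous.
  split=> // v.
  rewrite (_ : 'D_v _ = (cst (v * W) : R^o -> R^o) \* ((fun x : R^o => (w.[x])^-1 : R^o) \o z)).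
    apply: CkM; [exact: openT|exact: Ck_cst|].
    apply: (@Ck_comp_scal _ _ _ (@frame_R R) k setT setT) => //; first exact: openT.
    by apply: Ck_inv; [exact: openT|move=> x; rewrite gt_eqF].
  apply/funext => x /=.
  rewrite deriveE // -[v in LHS]mulr1 -[v * 1]/(v *: (1 : R^o)) linearZ /= -deriveE //.
  by rewrite derive_val -mulrA.
have s0 : s 0 = 0 by rewrite -[in LHS](prim0 w) sK.
have s1 : s W = 1 by rewrite /W sK.
have Iz t : I t -> I (z t).
  rewrite /= !in_itv /= => /andP[t0 t1]; apply/andP; split.
    by rewrite -s0; apply: s_homo; rewrite mulr_ge0 // ltW.
  by rewrite -s1; apply: s_homo; rewrite ler_piMr // ltW.
exists z; split=> //; first by rewrite /z mulr0.
  by rewrite /z mulr1.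
move=> t It; rewrite derive_val; split; first by rewrite divr_ge0 // ltW.
apply: le_trans Wle; rewrite lee_fin -mulrA ler_piMr //; first exact: ltW.
by rewrite mulrC ler_pdivrMr // mul1r; have /andP[] := wu _ (Iz t It).
Qed.

End Reparametrization.

(** * The norm of a function on M *)

Section SpaceNorm.
Context {R : realType} {M : pseudoPMetricType R}.
Hypothesis M_compact : compact [set: M].
Variable nu : {finite_measure set (borel M) -> \bar R}.
Local Notation I := (`[0%R, 1%R]%classic : set R).
Implicit Types (h g : M -> R) (H : R -> M -> R).

Lemma borel_open (U : set M) : open U -> measurable (U : set (borel M)).
Proof. by move=> oU; exact: sub_sigma_algebra. Qed.

Lemma continuous_borel h (D : set (borel M)) : continuous h ->
  measurable_fun D (h : borel M -> R).
Proof.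
move=> ch mD; apply: (measurability _ (RGenOpens.measurableE R)) => //.
move=> _ [_ [a [b ->] <-]]; apply: measurableI => //; apply: borel_open.
move/continuousP : ch; apply; exact: interval_open.
Qed.

Lemma continuous_bounded h : continuous h ->
  exists2 B, 0 <= B & forall x, `|h x| <= B.
Proof.
move=> ch; have cn : {within setT, continuous (fun x => `|h x|)}.
  apply: continuous_subspaceT => x; apply: continuous_comp (ch x) _.
  exact: norm_continuous.
have [|c _ cmax] := compact_EVT_max _ M_compact cn; first by exists point.
by exists `|h c| => // x; apply: cmax; exact: mem_set.
Qed.

Lemma finite_measure_lty (D : set (borel M)) : measurable D -> (nu D < +oo)%E.
Proof. by move=> mD; rewrite ltey_eq fin_num_measure. Qed.

Lemma continuous_integrable h (D : set (borel M)) : measurable D ->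
  continuous h -> nu.-integrable D (EFin \o h).
Proof.
move=> mD ch; have [B B0 hB] := continuous_bounded ch.
apply: measurable_bounded_integrable => //.
- exact: finite_measure_lty.
- exact: continuous_borel.
- exists B; split; first exact: num_real.
  by move=> y By x _ /=; apply: le_trans (hB x) (ltW By).
Qed.

Lemma Rintegral_osc h c e (D : set (borel M)) : measurable D -> continuous h ->
  (forall x, D x -> `|h x - c| <= e) ->
  `|\int[nu]_(x in D) h x - c * fine (nu D)| <= e * fine (nu D).
Proof.
move=> mD ch hc; have ih := continuous_integrable mD ch.
have ic (a : R) : nu.-integrable D (EFin \o (cst a : borel M -> R)).
  by apply: continuous_integrable => // x; exact: cvg_cst.
rewrite -(Rintegral_cst nu mD c) -RintegralB //; last exact: ic.
rewrite -(Rintegral_cst nu mD e).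
have ihc : nu.-integrable D (EFin \o (fun x => h x - c)).
  apply: continuous_integrable => // x; apply: cvgB; first exact: ch.
  exact: cvg_cst.
apply: le_trans (le_normr_Rintegral mD ihc) _.
apply: le_Rintegral => //; last exact: ic.
apply: (@continuous_integrable (fun x => `|h x - c|)) => // x.
apply: cvg_norm; apply: cvgB; [exact: ch|exact: cvg_cst].
Qed.

Let V := fine (nu setT).

Lemma V_ge0 : 0 <= V. Proof. exact: fine_ge0. Qed.

Definition space_mean h := V^-1 * \int[nu]_x h x.

Lemma space_normE h :
  space_norm nu h = sup (range h) - inf (range h) + `|space_mean h|.
Proof. by []. Qed.

Lemma le_sup_range h x : continuous h -> h x <= sup (range h).
Proof.
move=> ch; have [B _ hB] := continuous_bounded ch.
apply: ub_le_sup; last by exists x.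
by exists B => _ [y _ <-]; apply: le_trans (ler_norm _) (hB y).
Qed.

Lemma ge_inf_range h x : continuous h -> inf (range h) <= h x.
Proof.
move=> ch; have [B _ hB] := continuous_bounded ch.
apply: ge_inf; last by exists x.
by exists (- B) => _ [y _ <-]; have := hB y; rewrite ler_norml => /andP[].
Qed.

Lemma sup_range_le h c : (forall x, h x <= c) -> sup (range h) <= c.
Proof.
by move=> hc; apply: ge_sup; [exists (h point), point|move=> _ [y _ <-]].
Qed.

Lemma inf_range_ge h c : (forall x, c <= h x) -> c <= inf (range h).
Proof.
by move=> hc; apply: lb_le_inf; [exists (h point), point|move=> _ [y _ <-]].
Qed.

Lemma space_mean_le h C : continuous h -> (forall x, `|h x| <= C) ->
  `|space_mean h| <= C.
Proof.
move=> ch hC; have C0 : 0 <= C by apply: le_trans (hC point).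
have := @Rintegral_osc h 0 C setT measurableT ch.
rewrite mul0r subr0 => /(_ _)/wrap[x _|H]; first by rewrite subr0.
rewrite /space_mean normrM ger0_norm ?invr_ge0 ?V_ge0 //.
apply: le_trans (ler_wpM2l _ H) _; first by rewrite invr_ge0 V_ge0.
(* If nu has no mass, V^-1 is 0 by convention and so is the mean. *)
have [V0|V0] := eqVneq V 0; first by rewrite V0 invr0 mul0r.
by rewrite mulrCA -/V mulVf // mulr1.
Qed.

Lemma space_meanD h g : continuous h -> continuous g ->
  space_mean (h \+ g) = space_mean h + space_mean g.
Proof.
move=> ch cg; rewrite /space_mean RintegralD ?mulrDr //.
- exact: continuous_integrable.
- exact: continuous_integrable.
Qed.

Lemma space_norm_ge0 h : continuous h -> 0 <= space_norm nu h.
Proof.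
move=> ch; rewrite space_normE addr_ge0 // subr_ge0.
by apply: le_trans (ge_inf_range point ch) (le_sup_range point ch).
Qed.

Lemma space_normD h g : continuous h -> continuous g ->
  space_norm nu (h \+ g) <= space_norm nu h + space_norm nu g.
Proof.
move=> ch cg; rewrite !space_normE space_meanD //.
have := ler_normD (space_mean h) (space_mean g).
have : sup (range (h \+ g)) <= sup (range h) + sup (range g).
  by apply: sup_range_le => x; apply: lerD; exact: le_sup_range.
have : inf (range h) + inf (range g) <= inf (range (h \+ g)).
  by apply: inf_range_ge => x; apply: lerD; exact: ge_inf_range.
lra.
Qed.

(** The maximum, the opposite of the minimum and the mean contribute C each. *)
Lemma space_norm_le h C : continuous h -> (forall x, `|h x| <= C) ->
  space_norm nu h <= 3 * C.
Proof.
move=> ch hC; have := space_mean_le ch hC; rewrite space_normE.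
have : sup (range h) <= C.
  by apply: sup_range_le => x; apply: le_trans (ler_norm _) (hC x).
have : - C <= inf (range h).
  by apply: inf_range_ge => x; have := hC x; rewrite ler_norml => /andP[].
lra.
Qed.

Lemma space_normZ c h : 0 <= c -> continuous h ->
  space_norm nu (fun x => c * h x) <= c * space_norm nu h.
Proof.
move=> c0 ch; rewrite !space_normE.
have : sup (range (fun x => c * h x)) <= c * sup (range h).
  by apply: sup_range_le => x; apply: ler_wpM2l => //; exact: le_sup_range.
have : c * inf (range h) <= inf (range (fun x => c * h x)).
  by apply: inf_range_ge => x; apply: ler_wpM2l => //; exact: ge_inf_range.
have : `|space_mean (fun x => c * h x)| = c * `|space_mean h|.
  rewrite /space_mean RintegralZl //; last exact: continuous_integrable.
  by rewrite mulrCA normrM (ger0_norm c0).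
lra.
Qed.

(** With positive mass the mean m lies between minimum and maximum, so |h(x)| <= |m| + |h(x) - m| is
    at most |m| plus the oscillation. The location of m is expressed by its distance from the
    midpoint c, at most half the oscillation. *)
Lemma norm_le_space_norm h x : nu setT != 0%E -> continuous h ->
  `|h x| <= space_norm nu h.
Proof.
move=> nu0 ch; have V0 : 0 < V.
  rewrite lt_neqAle V_ge0 andbT eq_sym fine_eq0 //.
  exact: fin_num_measure.
set S := sup (range h); set J := inf (range h).
pose c := (S + J) / 2; pose e := (S - J) / 2.
have hx y : `|h y - c| <= e.
  have := le_sup_range y ch; have := ge_inf_range y ch; rewrite -/S -/J => a b.
  by rewrite ler_norml /c /e; apply/andP; split; lra.
have := @Rintegral_osc h c e setT measurableT ch (fun x _ => hx x); rewrite -/V.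
move=> H.
have {}H : `|space_mean h - c| <= e.
  have -> : space_mean h - c = V^-1 * (\int[nu]_x h x - c * V).
    by rewrite /space_mean; field; rewrite gt_eqF.
  rewrite normrM (ger0_norm (ltW _)) ?invr_gt0 // ler_pdivrMl //.
  by rewrite [leRHS]mulrC.
have := hx x; rewrite space_normE -/S -/J; move: H; rewrite /c /e.
move: (space_mean h) => m; rewrite !ler_norml => /andP[? ?] /andP[? ?].
apply/andP; split; have := ler_norm m; have := ler_norm (- m); rewrite normrN; lra.
Qed.

Lemma continuousB h g : continuous h -> continuous g ->
  continuous (fun x => h x - g x).
Proof. by move=> ch cg x; apply: cvgB; [exact: ch|exact: cg]. Qed.

Lemma space_norm_dist h g : continuous h -> continuous g ->
  space_norm nu h <= space_norm nu g + space_norm nu (fun x => h x - g x).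
Proof.
move=> ch cg; have := space_normD cg (continuousB ch cg).
rewrite (_ : g \+ _ = h) //; apply/funext => x /=.
by rewrite addrC subrK.
Qed.

Lemma space_norm_distC h g : continuous h -> continuous g ->
  space_norm nu (fun x => h x - g x) <= space_norm nu (fun x => g x - h x).
Proof.
move=> ch cg; rewrite !space_normE.
have cgh := continuousB cg ch.
have : sup (range (fun x => h x - g x)) <= - inf (range (fun x => g x - h x)).
  by apply: sup_range_le => x; rewrite -opprB lerN2; exact: (ge_inf_range x cgh).
have : - sup (range (fun x => g x - h x)) <= inf (range (fun x => h x - g x)).
  by apply: inf_range_ge => x; rewrite -opprB lerN2; exact: (le_sup_range x cgh).
have : `|space_mean (fun x => h x - g x)| = `|space_mean (fun x => g x - h x)|.
  rewrite /space_mean !normrM !RintegralB //; try exact: continuous_integrable.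
  by rewrite distrC.
lra.
Qed.

(** Interiors of balls are used so that the covering sets are open, hence Borel. *)
Lemma finite_net r : 0 < r ->
  exists s : seq M, forall x, exists2 y, y \in s & (ball y r)^° x.
Proof.
move=> r0; have := M_compact; rewrite compact_cover.
move=> /(_ M setT (fun y => (ball y r)^°))[].
- by move=> y _; exact: open_interior.
- move=> x _; exists x => //; rewrite /interior /=; exact: nbhsx_ballx.
- move=> D _ DT; exists (finmap.enum_fset D) => x.
  by have [y yD yx] := DT x Logic.I; exists y.
Qed.

(** A Riemann sum: D is cut into disjoint pieces by removing the balls one after the other, and h is
    sampled at the centres. It involves h only through finitely many evaluations, hence is
    measurable in t for a family of functions. *)
Fixpoint net_sum r (s : seq M) (D : set (borel M)) h : R :=
  match s with
  | [::] => 0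
  | y :: s' => h y * fine (nu (D `&` (ball y r)^°)) +
               net_sum r s' (D `\` (ball y r)^°) h
  end.

Lemma net_sum_approx r s (D : set (borel M)) h e : measurable D -> continuous h ->
  (forall x, D x -> exists2 y, y \in s & (ball y r)^° x) ->
  (forall x y, (ball y r)^° x -> `|h x - h y| <= e) ->
  `|\int[nu]_(x in D) h x - net_sum r s D h| <= e * fine (nu D).
Proof.
move=> mD ch Ds he; elim: s D mD Ds => [|y s IH] D mD Ds /=.
  have -> : D = set0 by apply/seteqP; split => x //= /Ds[].
  by rewrite Rintegral_set0 subr0 normr0 measure0 mulr0.
set B : set (borel M) := (ball y r)^°.
have mB : measurable B by apply: borel_open; exact: open_interior.
have mDB : measurable (D `&` B) by exact: measurableI.
have mDC : measurable (D `\` B) by exact: measurableD.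
have DE : D = (D `&` B) `|` (D `\` B) by rewrite setUC setDE -setIUr setUCl setIT.
have dj : (D `&` B) `&` (D `\` B) = set0.
  by apply/seteqP; split => x //= [[_ a] [_ b]].
have nuE : fine (nu D) = fine (nu (D `&` B)) + fine (nu (D `\` B)).
  rewrite {1}DE measureU // fineD //; exact: fin_num_measure.
have intE : \int[nu]_(x in D) h x =
    \int[nu]_(x in D `&` B) h x + \int[nu]_(x in D `\` B) h x.
  rewrite {1}DE Rintegral_setU // -?DE; first exact: continuous_integrable.
  by rewrite /disj_set dj.
have H1 : `|\int[nu]_(x in D `&` B) h x - h y * fine (nu (D `&` B))| <=
    e * fine (nu (D `&` B)).
  by apply: Rintegral_osc => // x [_ Bx]; exact: he.
have H2 := IH _ mDC.
have {}H2 := H2 (fun x Dx => _).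
rewrite intE nuE mulrDr opprD addrACA.
apply: le_trans (ler_normD _ _) (lerD H1 _).
apply: IH => // x [Dx nBx]; have [z] := Ds x Dx.
by rewrite inE => /predU1P[->|zs] zx //; exists z.
Qed.

Lemma net_sum_measurable r s (D : set (borel M)) H :
  (forall x, measurable_fun I (H ^~ x)) ->
  measurable_fun I (fun t => net_sum r s D (H t)).
Proof.
move=> mH; elim: s D => [|y s IH] D /=; first exact: measurable_cst.
apply: measurable_funD; last exact: IH.
by apply: measurable_funM; [exact: mH|exact: measurable_cst].
Qed.

Definition net_max (s : seq M) h : R := foldr (fun y a => Num.max (h y) a) (h point) s.

Lemma net_max_measurable s H : (forall x, measurable_fun I (H ^~ x)) ->
  measurable_fun I (fun t => net_max s (H t)).
Proof.
move=> mH; elim: s => [|y s IH] /=; first exact: mH.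
by apply: measurable_maxr => //; exact: mH.
Qed.

Lemma net_max_approx r s h e : continuous h ->
  (forall x, exists2 y, y \in s & (ball y r)^° x) ->
  (forall x y, (ball y r)^° x -> `|h x - h y| <= e) ->
  `|sup (range h) - net_max s h| <= e.
Proof.
move=> ch cs he.
have le1 : net_max s h <= sup (range h).
  elim: s {cs} => [|y s IH] /=; first exact: le_sup_range.
  by rewrite ge_max IH andbT le_sup_range.
have le2 y : y \in s -> h y <= net_max s h.
  elim: s {cs le1} => [//|z s IH] /=; rewrite inE le_max.
  by move=> /predU1P[->|/IH ->]; rewrite ?lexx ?orbT.
have le3 : sup (range h) <= net_max s h + e.
  apply: sup_range_le => x; have [y ys yx] := cs x.
  have := he _ _ yx; rewrite ler_norml => /andP[_ a].
  by have := le2 y ys; lra.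
by rewrite ger0_norm ?subr_ge0 //; lra.
Qed.

(** Suprema and integrals over M become pointwise limits of expressions in finitely many
    evaluations. The nets have mesh 1 / (k + 1) and do not depend on t, although the mesh needed for
    a given accuracy does. *)
Lemma measurable_family_lim (F : R -> R) (f : R -> seq M -> R -> R) :
  (forall r s, measurable_fun I (f r s)) ->
  (forall t, I t -> forall e, 0 < e -> exists2 r0, 0 < r0 & forall r s, 0 < r -> r <= r0 ->
    (forall x, exists2 y, y \in s & (ball y r)^° x) -> `|F t - f r s t| <= e) ->
  measurable_fun I F.
Proof.
move=> mf fF; have r0 k : 0 < k.+1%:R^-1 :> R by rewrite invr_gt0.
have ns k : {s : seq M | forall x, exists2 y, y \in s & (ball y k.+1%:R^-1)^° x}.
  by apply: cid; exact: finite_net.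
apply: (@measurable_fun_cvg _ _ _ _ (fun k => f k.+1%:R^-1 (sval (ns k)))) => //.
move=> t It; apply/cvgrPdist_le => e e0.
have [d d0 H] := fF t It e e0.
near=> k; apply: H => //; last exact: (svalP (ns k)).
by apply/ltW; near: k; exact: (near_infty_natSinv_lt (PosNum d0)).
Unshelve. all: by end_near. Qed.

Lemma continuous_osc h e : continuous h -> 0 < e -> exists2 r, 0 < r &
  forall x y, (ball y r)^° x -> `|h x - h y| <= e.
Proof.
move=> ch e0.
have ch' : {within setT, continuous h} by exact: continuous_subspaceT.
have [d d0 hd] := compact_unif_continuous M_compact ch' e0.
exists d => // x y /interior_subset yx.
by rewrite distrC; apply/ltW; exact: (hd y x).
Qed.

Definition measurable_family H :=
  (forall t, I t -> continuous (H t)) /\ forall x, measurable_fun I (H ^~ x).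

Lemma interior_ball_mono (y : M) r1 r2 x : r1 <= r2 ->
  (ball y r1)^° x -> (ball y r2)^° x.
Proof. by move=> r12; apply: filterS => z; exact: le_ball. Qed.

Lemma space_norm_measurable H : measurable_family H ->
  measurable_fun I (fun t => space_norm nu (H t)).
Proof.
move=> [cH mH].
have msup (K : R -> M -> R) : (forall t, I t -> continuous (K t)) ->
    (forall x, measurable_fun I (K ^~ x)) ->
    measurable_fun I (fun t => sup (range (K t))).
  move=> cK mK; apply: (measurable_family_lim (f := fun r s t => net_max s (K t))).
    by move=> r s; exact: net_max_measurable.
  move=> t It e e0; have [r0 r00 osc] := continuous_osc (cK t It) e0.
  exists r0 => // r s rp rr cs; apply: net_max_approx cs _; first exact: cK.
  by move=> x y /(interior_ball_mono rr); exact: osc.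
rewrite (_ : (fun t => _) = fun t => sup (range (H t)) - inf (range (H t)) + `|space_mean (H t)|) //.
apply: measurable_funD.
  apply: measurable_funB; first exact: msup.
  rewrite (_ : (fun t => _) = \- (fun t => sup (range (fun x => - H t x)))).
    apply: measurableT_comp => //; apply: msup => [t It x|x].
      by apply: cvgN; exact: cH.
    by apply: measurableT_comp => //; exact: mH.
  apply/funext => t; rewrite /inf /=; congr (- sup _).
  by apply/seteqP; split => y /=; [move=> [_ [x _ <-] <-]; exists x|move=> [x _ <-]; exists (H t x) => //; exists x].
apply: measurableT_comp; first exact: normr_measurable.
apply: measurable_funM; first exact: measurable_cst.
apply: (measurable_family_lim (f := fun r s t => net_sum r s setT (H t))).
  by move=> r s; exact: net_sum_measurable.
move=> t It e e0.
(* V + 1 replaces V, which may be 0 here. *)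
have e1 : 0 < e / (V + 1) by rewrite divr_gt0 // ltr_wpDl ?V_ge0.
have [r0 r00 osc] := continuous_osc (cH t It) e1.
exists r0 => // r s rp rr cs.
apply: (@le_trans _ _ (e / (V + 1) * V)).
  apply: (@net_sum_approx r s setT) => //; first exact: cH.
  by move=> x y /(interior_ball_mono rr); exact: osc.
have V0 := V_ge0.
rewrite mulrAC ler_pdivrMr; last by lra.
by rewrite ler_wpM2l ?ltW //; lra.
Qed.

Lemma measurable_familyB H K : measurable_family H -> measurable_family K ->
  measurable_family (fun t x => H t x - K t x).
Proof.
move=> [cH mH] [cK mK]; split=> [t It|x].
  by apply: continuousB; [exact: cH|exact: cK].
by apply: measurable_funB; [exact: mH|exact: mK].
Qed.

Lemma norm_1infty_le H K L : measurable_family H -> measurable_family K ->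
  measurable_family L ->
  (forall t, I t -> space_norm nu (H t) <= space_norm nu (K t) + space_norm nu (L t)) ->
  (norm_1infty nu H <= norm_1infty nu K + norm_1infty nu L)%E.
Proof.
move=> mH mK mL HKL; rewrite /norm_1infty /=.
have mE K' : measurable_family K' ->
    measurable_fun I (fun t => (space_norm nu (K' t))%:E).
  by move=> mK'; apply/measurable_EFinP; exact: space_norm_measurable.
rewrite -ge0_integralD //.
- apply: ge0_le_integral => //.
  + by move=> t It; rewrite lee_fin; apply: space_norm_ge0; exact: mH.1.
  + exact: mE.
  + by apply: emeasurable_funD; exact: mE.
- by move=> t It; rewrite lee_fin; apply: space_norm_ge0; exact: mK.1.
- exact: mE.
- by move=> t It; rewrite lee_fin; apply: space_norm_ge0; exact: mL.1.
- exact: mE.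
Qed.

Lemma norm_1infty_mulr_le H K C : measurable_family H -> measurable_family K ->
  0 <= C -> (forall t, I t -> space_norm nu (H t) <= C * space_norm nu (K t)) ->
  (norm_1infty nu H <= C%:E * norm_1infty nu K)%E.
Proof.
move=> mH mK C0 HK; rewrite /norm_1infty /=.
have mE K' : measurable_family K' ->
    measurable_fun I (fun t => (space_norm nu (K' t))%:E).
  by move=> mK'; apply/measurable_EFinP; exact: space_norm_measurable.
rewrite -ge0_integralZl_EFin //.
- apply: ge0_le_integral => //.
  + by move=> t It; rewrite lee_fin; apply: space_norm_ge0; exact: mH.1.
  + exact: mE.
  + by apply: measurable_funeM; exact: mE.
- by move=> t It; rewrite lee_fin; apply: space_norm_ge0; exact: mK.1.
- exact: mE.
Qed.

End SpaceNorm.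

(** * Positivity of the contact volume *)

(* Unlike ge0_le_integral, no measurability: the integral of a nonnegative
   function is a supremum over simple functions below it. *)
Lemma ge0_le_integral_nomeas d (T : measurableType d) (R : realType)
    (mu : {measure set T -> \bar R}) (f g : T -> \bar R) :
  (forall x, (0 <= f x)%E) -> (forall x, (f x <= g x)%E) ->
  (\int[mu]_x f x <= \int[mu]_x g x)%E.
Proof.
move=> f0 fg; rewrite !ge0_integralTE //; last first.
  by move=> x; apply: le_trans (f0 x) (fg x).
apply: ereal_sup_le => _ [h hf <-]; exists h => // x.
exact: le_trans (hf x) (fg x).
Qed.

(** * Bounds for iterated integrals over boxes *)

Section BoxBounds.
Context {R : realType}.
Local Notation mu := (@lebesgue_measure R).

(** Comparison with a multiple of the indicator of [-L, L]. In the application f is an inner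
    iterated integral, about which only bounds are known. *)
Lemma Rintegral_box_le (f : R -> R) (B L : R) : 0 <= L ->
  (forall x, 0 <= f x <= B) -> (forall x, L < `|x| -> f x = 0) ->
  (0 <= \int[mu]_x (f x)%:E <= (B * (2 * L))%:E)%E.
Proof.
move=> L0 fB f0; apply/andP; split.
  by apply: integral_ge0 => x _; rewrite lee_fin; have /andP[] := fB x.
have -> : ((B * (2 * L))%:E = \int[mu]_x (B * \1_(`[- L, L]) x)%:E)%E.
  under eq_integral do rewrite EFinM.
  have B0 : 0 <= B by have /andP[] := fB 0; exact: le_trans.
  rewrite ge0_integralZl_EFin //; first last.
  - by apply/measurable_EFinP; exact: measurable_indic.
  rewrite integral_indic //= setIT lebesgue_measure_itv /= lte_fin.
  have [LL|LL] := ltP (- L) L; first by rewrite -EFinB -EFinM opprK; congr (_ * _)%:E; ring.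
  have -> : L = 0 by lra.
  by rewrite !mulr0 mule0.
apply: ge0_le_integral_nomeas => x; first by rewrite lee_fin; have /andP[] := fB x.
rewrite lee_fin indicE; case: (boolP (x \in _)) => [_|].
  by rewrite mulr1; have /andP[] := fB x.
rewrite mulr0 notin_setE /= => /negP.
by rewrite in_itv /= -ler_norml -ltNge => /f0 ->.
Qed.

Lemma Rintegral_box_ge (f : R -> R) (c p r : R) : 0 <= r ->
  (forall x, 0 <= f x) -> 0 <= c -> (forall x, `|x - p| <= r -> c <= f x) ->
  ((c * (2 * r))%:E <= \int[mu]_x (f x)%:E)%E.
Proof.
move=> r0 f0 c0 fc.
have -> : ((c * (2 * r))%:E = \int[mu]_x (c * \1_(`[p - r, p + r]) x)%:E)%E.
  under eq_integral do rewrite EFinM.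
  rewrite ge0_integralZl_EFin //; first last.
  - by apply/measurable_EFinP; exact: measurable_indic.
  rewrite integral_indic //= setIT lebesgue_measure_itv /= lte_fin.
  have [LL|LL] := ltP (p - r) (p + r); first by rewrite -EFinB -EFinM; congr (_ * _)%:E; ring.
  have -> : r = 0 by lra.
  by rewrite !mulr0 mule0.
apply: ge0_le_integral_nomeas => x.
  by rewrite lee_fin mulr_ge0 // indicE.
rewrite lee_fin indicE; case: (boolP (x \in _)) => [|_]; last by rewrite mulr0.
rewrite inE /= in_itv /= => /andP[px xp]; rewrite mulr1; apply: fc.
by rewrite ler_norml; apply/andP; split; lra.
Qed.

Lemma cons_row0 m x (v : 'rV[R]_m) :
  (row_mx (x%:M : 'rV[R]_1) v : 'rV[R]_m.+1) ord0 (@lshift 1 m ord0) = x.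
Proof. by apply: etrans (row_mxEl _ _ _ _) _; rewrite mxE eqxx. Qed.

Lemma cons_rowS m x (v : 'rV[R]_m) (j : 'I_m) :
  (row_mx (x%:M : 'rV[R]_1) v : 'rV[R]_m.+1) ord0 (rshift 1 j : 'I_m.+1) = v ord0 j.
Proof. exact: row_mxEr. Qed.

(** The upper bound serves finiteness: a real integral is [fine] of an extended one, and bounds pass
    through [fine] only for finite values. *)
Lemma rV_integral_le m (g : 'rV[R]_m -> R) (B L : R) : 0 <= L ->
  (forall v, 0 <= g v <= B) -> (forall (v : 'rV[R]_m) j, L < `|v ord0 j| -> g v = 0) ->
  0 <= rV_integral g <= B * (2 * L) ^+ m.
Proof.
move=> L0; elim: m g B => [|m IH] g B gB g0 /=; first by rewrite mulr1.
set f := fun x => _.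
have fB x : 0 <= f x <= B * (2 * L) ^+ m.
  apply: IH => [v|v j Lv]; first exact: gB.
  by apply: (g0 _ (rshift 1 j)); rewrite cons_rowS.
have f0 x : L < `|x| -> f x = 0.
  (* Off [-L, L] the slice of g vanishes, so the induction hypothesis applies with bound 0. *)
  move=> Lx; have : 0 <= f x <= 0 * (2 * L) ^+ m.
    apply: IH => [v|v j _]; last first.
      by rewrite (g0 _ (@lshift 1 m ord0)) // cons_row0.
    by rewrite (g0 _ (@lshift 1 m ord0)) ?lexx // cons_row0.
  by rewrite mul0r => /andP[a b]; apply/eqP; rewrite eq_le a b.
have := Rintegral_box_le L0 fB f0; rewrite /Rintegral => /andP[a b].
have fin : (\int[mu]_x (f x)%:E)%E \is a fin_num.
  by rewrite ge0_fin_numE //; apply: le_lt_trans b (ltry _).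
by rewrite fine_ge0 //= -lee_fin fineK // exprSr mulrA.
Qed.

Lemma rV_integral_ge m (g : 'rV[R]_m -> R) (B L c r : R) (p : 'rV[R]_m) :
  0 <= L -> 0 <= r -> 0 <= c ->
  (forall v, 0 <= g v <= B) -> (forall (v : 'rV[R]_m) j, L < `|v ord0 j| -> g v = 0) ->
  (forall v : 'rV[R]_m, (forall j, `|v ord0 j - p ord0 j| <= r) -> c <= g v) ->
  c * (2 * r) ^+ m <= rV_integral g.
Proof.
move=> L0 r0 c0; elim: m g B p => [|m IH] g B p gB g0 gc /=.
  by rewrite mulr1; apply: gc => -[].
set f := fun x => _.
have g0' x (v : 'rV[R]_m) j : L < `|v ord0 j| -> g (row_mx (x%:M : 'rV_1) v) = 0.
  by move=> Lv; apply: (g0 _ (rshift 1 j)); rewrite cons_rowS.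
have fB x : 0 <= f x <= B * (2 * L) ^+ m.
  by apply: rV_integral_le => // v j; exact: g0'.
have f0 x : L < `|x| -> f x = 0.
  move=> Lx; have : 0 <= f x <= 0 * (2 * L) ^+ m.
    apply: rV_integral_le => // [v|v j _];
    by rewrite (g0 _ (@lshift 1 m ord0)) ?lexx // cons_row0.
  by rewrite mul0r => /andP[a b]; apply/eqP; rewrite eq_le a b.
have fc x : `|x - p ord0 (@lshift 1 m ord0)| <= r -> c * (2 * r) ^+ m <= f x.
  move=> xp; apply: (IH _ B (rsubmx (p : 'rV_(1 + m)))) => // [v j|v vp]; first exact: g0'.
  apply: gc => j; case: (split_ordP (j : 'I_(1 + m))) => k ->.
    by rewrite !ord1 cons_row0.
  by rewrite cons_rowS; have := vp k; rewrite mxE.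
have := Rintegral_box_le L0 fB f0; rewrite /Rintegral => /andP[a b].
have fin : (\int[mu]_x (f x)%:E)%E \is a fin_num.
  by rewrite ge0_fin_numE //; apply: le_lt_trans b (ltry _).
rewrite -lee_fin fineK // exprSr mulrA.
apply: (Rintegral_box_ge r0 _ _ fc).
- by move=> x; have /andP[] := fB x.
- by rewrite mulr_ge0 // exprn_ge0 // mulr_ge0.
Qed.

End BoxBounds.

(** * Positive mass from a bump function in a chart *)

Section PositiveVolume.
Context {R : realType} {n : nat} {M : pseudoPMetricType R}.
Context {A : smooth_atlas R n.*2.+1 M} (alpha : one_form A).

Lemma contact_density_continuous (i : chart A) x : dom i x ->
  {for coord i x, continuous (contact_density alpha i)}.
Proof.
move=> ix; have ip : (coord i @` dom i) (coord i x) by exists x.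
have oi := @img_open _ _ _ _ i.
have sc k : smooth_on (coord i @` dom i) (rV_crd k \o coef alpha i).
  by move=> K; apply: Ck_lin => //; [exact: rV_crd_continuous|exact: coef_smooth].
have cc k : {for coord i x, continuous (fun p => coef alpha i p ord0 k)}.
  exact: (smooth_on_continuous (sc k) ip).
have cD k l : {for coord i x, continuous (fun p =>
    'D_(delta_mx ord0 k) (fun q => coef alpha i q ord0 l) p)}.
  exact: (smooth_on_continuous (smooth_on_derive (delta_mx ord0 k) (sc l)) ip).
have cd k l : {for coord i x, continuous (fun p => dform alpha i p k l)}.
  exact: (cvgB (cD k l) (cD l k)).
have gen (B : set_system 'rV[R]_n.*2.+1) : Filter B ->
    (forall k, coef alpha i q ord0 k @[q --> B] --> coef alpha i (coord i x) ord0 k) ->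
    (forall k l, dform alpha i q k l @[q --> B] --> dform alpha i (coord i x) k l) ->
    contact_density alpha i q @[q --> B] --> contact_density alpha i (coord i x).
  move=> FB cB dB; rewrite /contact_density; apply: cvgM; first exact: cvg_cst.
  apply: cvg_big => [|s _]; first exact: add_continuous.
  apply: cvgM; first by apply: cvgM; [exact: cvg_cst|exact: cB].
  by apply: cvg_big => [|k _]; [exact: mul_continuous|exact: dB].
exact: (gen (nbhs (coord i x)) _ cc cd).
Qed.

(** If nu(M) = 0, a bump function supported in a chart around the base point has integral 0; but on
    a small cube its integrand in the chart is bounded below by a positive constant, the density
    being continuous and nonzero. *)
Lemma contact_volume_neq0 (nu : {finite_measure set (borel M) -> \bar R}) :
  contact_form alpha -> contact_volume alpha nu -> nu setT != 0%E.
Proof.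
move=> ac nuE; apply/eqP => nu0.
have [i ix] := dom_cover A point; set x := point in ix.
set p := coord i x; pose D := contact_density alpha i.
have D0 : 0 < `|D p| by rewrite normr_gt0; exact: ac.
have ip : (coord i @` dom i) p by exists x.
have nD : \forall q \near p, (coord i @` dom i) q /\ `|D p - D q| < `|D p| / 2.
  apply: filterI; first exact: img_nbhs.
  have cD := contact_density_continuous ix.
  by move/cvgrPdist_lt : cD; apply; rewrite divr_gt0.
have [r /= r0 rD] := (nbhs_ballP _ _).1 nD.
have DB q : ball p r q -> `|D p| / 2 <= `|D q| <= 2 * `|D p|.
  move=> /rD[_ H]; have := ler_normD (D q) (D p - D q); rewrite subrKC => H1.
  have := ler_normB (D p) (D p - D q); rewrite subKr => H2.
  by apply/andP; split; lra.
pose W : set M := dom i `&` coord i @^-1` (ball p r).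
have oW : open W.
  rewrite openE => y [iy py]; apply: filterI; first exact: dom_nbhs.
  apply: (coord_cont iy); apply: open_nbhs_nbhs; split=> //.
  exact: ball_open.
have clW : closed (~` W) by exact: open_closedC.
have nWx : ~ (~` W) x by apply; split=> //=; exact: ballxx.
have := @point_uniform_separator R M x _ clW nWx.
move=> /(@uniform_separatorP _ R)[f [cf f01 fx fW]].
have fx0 : f x = 0 by apply: fx; exists x.
have fW1 y : ~ W y -> f y = 1 by move=> Wy; apply: fW; exists y.
have fI y : 0 <= f y <= 1.
  by have : (f @` setT) (f y) by [exists y]; move=> /f01; rewrite /= in_itv.
pose h y := Num.max 0 (2^-1 - f y).
have ch : continuous h.
  move=> y; apply: (continuous_max (f := fun=> 0) (g := fun y => 2^-1 - f y)).
    exact: cvg_cst.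
  by apply: cvgB; [exact: cvg_cst|exact: cf].
have h1 y : 0 <= h y <= 1.
  by rewrite /h le_max lexx ge_max ler01 /=; have := fI y; lra.
have hW y : h y != 0 -> W y.
  move=> hy; apply: contrapT => /fW1 fy; move: hy.
  by rewrite /h fy max_l ?eqxx //; lra.
have hcl : closure [set y | h y != 0] `<=` dom i.
  apply: (@subset_trans _ (f @^-1` [set s | s <= 2^-1])).
    have clf : closed (f @^-1` [set s | s <= 2^-1]).
      by apply: closed_comp; [move=> y _; exact: cf|exact: closed_le].
    rewrite [X in _ `<=` X]((closure_id _).1 clf); apply: closureS => y /=.
    apply: contraNT; rewrite -ltNge => fy.
    by rewrite /h max_l //; lra.
  move=> y /= fy; apply: contrapT => iy; have := fW1 y; rewrite /W => H.
  by move: fy; rewrite H; [lra|move=> []].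
have E := nuE i h ch hcl.
have E0 : \int[nu]_y h y = 0.
  rewrite /Rintegral.
  have H1 : (0 <= \int[nu]_y (h y)%:E)%E.
    by apply: integral_ge0 => y _; rewrite lee_fin; have /andP[] := h1 y.
  have H2 : (\int[nu]_y (h y)%:E <= \int[nu]_y (cst 1%E y))%E.
    apply: ge0_le_integral_nomeas => y; rewrite lee_fin; have /andP[] := h1 y => //.
  have I1 : (\int[nu]_y cst 1%:E y = 1%:E * nu setT)%E by exact: integral_cst.
  move: H2; rewrite I1 nu0 mule0 => H2.
  by have /eqP -> : (\int[nu]_y (h y)%:E)%E == 0%E by rewrite eq_le H1 H2.
pose g q := \1_(coord i @` dom i) q * (h (chart_inv i q) * `|D q|).
have gW q : g q != 0 -> ball p r q.
  rewrite /g indicE; case: (boolP (q \in _)) => [|_]; last by rewrite mul0r eqxx.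
  rewrite inE => -[y iy <-]; rewrite mul1r coordK // => H.
  have /hW[] // : h y != 0.
  by apply: contraNneq H => ->; rewrite mul0r.
have gB q : 0 <= g q <= 2 * `|D p|.
  have g0 : 0 <= g q.
    rewrite /g indicE; do 2 (apply: mulr_ge0 => //).
    by have /andP[] := h1 (chart_inv i q).
  rewrite g0 /=; have [->|/gW /DB/andP[_ H]] := eqVneq (g q) 0; first by lra.
  have := h1 (chart_inv i q); rewrite /g indicE.
  case: (q \in _); rewrite ?mul1r ?mul0r; last by lra.
  by move=> /andP[a b]; apply: le_trans H; rewrite ler_piMl.
pose L := `|p| + r.
have L0 : 0 <= L by rewrite addr_ge0 // ltW.
have g0 (q : 'rV[R]_n.*2.+1) j : L < `|q ord0 j| -> g q = 0.
  move=> Lq; apply/eqP; apply: contraTT Lq => /gW pq; rewrite -leNgt.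
  have H1 : `|q ord0 j| <= `|q|.
    rewrite [leRHS]/Num.Def.normr /= mx_normrE.
    exact: (le_bigmax _ (fun ij => `|q ij.1 ij.2|) (ord0, j)).
  apply: le_trans H1 _; rewrite -ball_normE /= in pq.
  have := ler_normB p (p - q); rewrite subKr /L => H; apply: le_trans H _.
  by rewrite lerD2l ltW.
have nfp : \forall q \near p, f (chart_inv i q) < 4^-1.
  have cfi : {for p, continuous (f \o chart_inv i)}.
    apply: continuous_comp; [exact: chart_inv_cont|exact: cf].
  have H : f (chart_inv i p) < 4^-1 by rewrite coordK // fx0 invr_gt0.
  exact: (cvgr_lt _ cfi _ H).
have [r1 /= r10 r1f] := (nbhs_ballP _ _).1 nfp.
(* Halving puts the closed cube of radius r2 inside both open balls. *)
pose r2 := Num.min r r1 / 2.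
have r20 : 0 < r2 by rewrite divr_gt0 // lt_min r0 r10.
have r2r : r2 < r.
  have : Num.min r r1 <= r by rewrite ge_min lexx.
  by have : 0 < Num.min r r1 by [rewrite lt_min r0 r10]; rewrite /r2; lra.
have r2r1 : r2 < r1.
  have : Num.min r r1 <= r1 by rewrite ge_min lexx orbT.
  by have : 0 < Num.min r r1 by [rewrite lt_min r0 r10]; rewrite /r2; lra.
(* The factor 1/8 is 1/4, a lower bound of h where f < 1/4, times 1/2 from |D q| >= |D p| / 2. *)
have gc (q : 'rV[R]_n.*2.+1) : (forall j, `|q ord0 j - p ord0 j| <= r2) -> `|D p| / 8 <= g q.
  move=> qp; have pq : `|p - q| <= r2.
    rewrite [leLHS]/Num.Def.normr /= mx_normrE (bigmax_le _ (ltW r20)) //= => -[a b] _.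
    by rewrite !mxE /= distrC ord1; exact: qp.
  have pqr : ball p r q by rewrite -ball_normE /=; exact: le_lt_trans r2r.
  have [iq _] := rD q pqr; have /andP[d1 _] := DB q pqr.
  have fq : f (chart_inv i q) < 4^-1.
    by apply: r1f; rewrite -ball_normE /=; exact: le_lt_trans r2r1.
  rewrite /g indicE mem_set // mul1r.
  have hq : 4^-1 <= h (chart_inv i q) by rewrite /h le_max; apply/orP; right; lra.
  apply: (@le_trans _ _ (4^-1 * (`|D p| / 2))); first by lra.
  by apply: ler_pM => //; rewrite ?divr_ge0.
have := rV_integral_ge (p := p) L0 (ltW r20) _ gB g0 gc.
rewrite -E E0 => /(_ _)/wrap[|]; first by rewrite divr_ge0.
rewrite leNgt => /negP; apply; apply: mulr_gt0; first by rewrite divr_gt0.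
by rewrite exprn_gt0 // mulr_gt0.
Qed.

End PositiveVolume.

(** * Uniform limits of isotopies and Hamiltonians *)

Section UniformLimits.
Context {R : realType} {M : pseudoPMetricType R}.
Local Notation I := (`[0%R, 1%R]%classic : set R).
Implicit Types (F G : R -> M -> M) (H : R -> M -> R).

(** The step number is carried along with the state, so that the invariant P and the relation Q may
    vary from step to step. *)
Lemma dependent_choice_seq (T : Type) (P : nat -> T -> Prop)
    (Q : nat -> T -> T -> Prop) x0 : P 0%N x0 ->
  (forall k x, P k x -> exists y, P k.+1 y /\ Q k x y) ->
  exists u : nat -> T, u 0%N = x0 /\ forall k, P k (u k) /\ Q k (u k) (u k.+1).
Proof.
move=> P0 PQ.
pose X := {kx : nat * T | P kx.1 kx.2}.
pose S (a b : X) := (sval b).1 = (sval a).1.+1 /\ Q (sval a).1 (sval a).2 (sval b).2.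
have [a|f [f0 fS]] := @dependent_choice X S _ (exist _ (0%N, x0) P0).
  apply: cid; have [y [Py Qy]] := PQ _ _ (svalP a).
  by exists (exist _ ((sval a).1.+1, y) Py).
have fk k : (sval (f k)).1 = k.
  by elim: k => [|k IH]; [rewrite f0|rewrite (fS k).1 IH].
exists (fun k => (sval (f k)).2); split; first by rewrite f0.
move=> k; split; first by have := svalP (f k); rewrite fk.
by have := (fS k).2; rewrite fk.
Qed.

Lemma uniform_limitP (Fs : nat -> R -> M -> M) F : uniform_limit Fs F <->
  forall e, 0 < e -> \forall k \near \oo, forall t x, I t ->
    ball (F t x) e (Fs k t x).
Proof.
rewrite /uniform_limit /=; split=> [FF e e0|FF].
  have /FF : nbhs ((fun q : R * M => F q.1 q.2) : {uniform` I `*` setT -> M})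
      [set h | forall q, (I `*` setT) q -> ball (F q.1 q.2) e (h q)].
    apply/uniform_nbhs; exists [set xy | ball xy.1 e xy.2]; split.
      by rewrite -entourage_ballE; exists e.
    by move=> h /= hE q qI; exact: hE.
  move=> H0; have {}H0 : \forall k \near \oo, forall q : R * M,
    (I `*` setT) q -> ball (F q.1 q.2) e (Fs k q.1 q.2) by exact: H0.
  by apply: filterS H0 => k H t x It; exact: (H (t, x) (conj It Logic.I)).
move=> P /uniform_nbhs[E [entE EP]].
have [e /= e0 eE] : exists2 e : R, 0 < e & [set xy | ball xy.1 e xy.2] `<=` E.
  by move: entE; rewrite -entourage_ballE => -[e e0 eE]; exists e.
have := FF e e0; apply: filterS => k H; apply: EP => -[t x] [/= It _].
by apply: eE; exact: H.
Qed.

Section CauchyLimit.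
Variable Y : pseudoPMetricType R.
Hypothesis Y_complete : forall G : set_system Y, ProperFilter G -> cauchy G -> cvg G.
Variables (Fs : nat -> R -> M -> Y) (e : R).
Hypothesis e0 : 0 < e.
Hypothesis FsE : forall k t x, I t -> ball (Fs k t x) (e * 2^-1 ^+ k) (Fs k.+1 t x).

Lemma geometric_gt0 k : 0 < e * 2^-1 ^+ k.
Proof. by rewrite mulr_gt0 // exprn_gt0 // invr_gt0. Qed.

Lemma geometric_ball k d t x : I t ->
  ball (Fs k t x) (2 * (e * 2^-1 ^+ k)) (Fs (k + d) t x).
Proof.
move=> It; elim: d k => [|d IH] k.
  by rewrite addn0; apply: ballxx; rewrite mulr_gt0 // geometric_gt0.
have -> : 2 * (e * 2^-1 ^+ k) = e * 2^-1 ^+ k + 2 * (e * 2^-1 ^+ k.+1).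
  by rewrite exprS; field.
rewrite -addSnnS; apply: ball_triangle (IH k.+1).
exact: FsE.
Qed.

Lemma geometric_small r : 0 < r -> exists k0, forall k, (k0 <= k)%N -> e * 2^-1 ^+ k < r.
Proof.
move=> r0.
have : (fun k => e * 2^-1 ^+ k) @ \oo --> (0 : R).
  by apply: cvg_geometric; rewrite ger0_norm // invf_lt1 // ltr1n.
move=> /cvgrPdist_lt /(_ r r0)[k0 _ H]; exists k0 => k /H.
by rewrite sub0r normrN ger0_norm // ltW // geometric_gt0.
Qed.

(** The tail of the geometric series accounts for 2, and the distance from the limit to a far term
    for 1 more. *)
Lemma geometric_limit : exists F : R -> M -> Y, forall k t x, I t ->
  ball (F t x) (3 * (e * 2^-1 ^+ k)) (Fs k t x).
Proof.
have lim_ex t x : I t -> exists y, forall k, ball y (3 * (e * 2^-1 ^+ k)) (Fs k t x).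
  move=> It.
  have cF : cvg (Fs ^~ t ^~ x @ \oo).
    apply: Y_complete; apply: cauchy_exP => r r0.
    have r20 : 0 < r / 2 by rewrite divr_gt0.
    have [k0 k0r] := geometric_small r20.
    exists (Fs k0 t x), k0 => //= k /= kk.
    apply: (@le_ball _ _ _ (2 * (e * 2^-1 ^+ k0))).
      by have := k0r k0 (leqnn _); lra.
    by rewrite -(subnKC kk); exact: geometric_ball.
  exists (lim (Fs ^~ t ^~ x @ \oo)) => k.
  have [k1 _ Hk1] := cF _ (nbhsx_ballx _ _ (geometric_gt0 k)).
  pose j := (k + k1)%N.
  have jE : ball (Fs k t x) (2 * (e * 2^-1 ^+ k)) (Fs j t x) by exact: geometric_ball.
  have Hj : ball (lim (Fs ^~ t ^~ x @ \oo)) (e * 2^-1 ^+ k) (Fs j t x).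
    by apply: Hk1; rewrite /= leq_addl.
  have -> : 3 * (e * 2^-1 ^+ k) = e * 2^-1 ^+ k + 2 * (e * 2^-1 ^+ k) by ring.
  by apply: ball_triangle Hj _; apply: ball_sym.
pose F t x := if pselect (I t) is left It then sval (cid (lim_ex t x It)) else point.
exists F => k t x It; rewrite /F; case: pselect => // It'.
exact: (svalP (cid (lim_ex t x It'))).
Qed.

End CauchyLimit.

Lemma continuous_of_close (Y : pseudoPMetricType R) (Fs : nat -> R -> M -> Y)
    (F : R -> M -> Y) :
  (forall e, 0 < e -> exists k, forall t x, I t -> ball (F t x) e (Fs k t x)) ->
  (forall k, {within I `*` setT, continuous (fun q : R * M => Fs k q.1 q.2)}) ->
  {within I `*` setT, continuous (fun q : R * M => F q.1 q.2)}.
Proof.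
move=> FF cF; apply/within_I_continuousP => t x It B.
move=> /nbhs_ballP[e /= e0 eB].
have e30 : 0 < e / 3 by rewrite divr_gt0.
have [k Fk] := FF _ e30.
have := (within_I_continuousP (Fs k)).1 (cF k) t x It _ (nbhsx_ballx _ _ e30).
apply: filterS => q + Iq => /(_ Iq) Hq; apply: eB.
have -> : e = e / 3 + (e / 3 + e / 3) by field.
apply: ball_triangle (Fk t x It) _; apply: ball_triangle Hq _.
by apply: ball_sym; exact: Fk.
Qed.

Section Compact.
Hypothesis M_compact : compact [set: M].

Lemma isotopy_unif_continuous F : isotopy_continuous F -> forall e, 0 < e ->
  exists2 d, 0 < d & forall t x y, I t -> ball x d y -> ball (F t x) e (F t y).
Proof.
move=> cF e e0.
have cIM : compact (I `*` [set: M]).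
  by apply: compact_setX => //; exact: segment_compact.
have [d d0 H] := compact_unif_continuous cIM cF e0.
exists d => // t x y It xy; apply: (H (t, x) (t, y)) => //.
by split=> //=; exact: ballxx.
Qed.

Lemma family_unif_continuous H : {within I `*` setT, continuous (fun q : R * M => H q.1 q.2)} ->
  forall e, 0 < e -> exists2 d, 0 < d & forall s t x, I s -> I t -> ball s d t ->
    `|H s x - H t x| < e.
Proof.
move=> cH e e0.
have cIM : compact (I `*` [set: M]).
  by apply: compact_setX => //; exact: segment_compact.
have [d d0 HH] := compact_unif_continuous cIM cH e0.
exists d => // s t x Is It st; apply: (HH (s, x) (t, x)) => //.
by split=> //=; exact: ballxx.
Qed.

Lemma continuous_slice H t : {within I `*` setT, continuous (fun q : R * M => H q.1 q.2)} ->
  I t -> continuous (H t).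
Proof.
move=> /within_I_continuousP cH It x B nB.
have [[P Q] [/= tP xQ] PQ] := cH t x It B nB.
apply: filterS xQ => y Qy; apply: (PQ (t, y)) => //; split=> //=.
exact: nbhs_singleton.
Qed.

Lemma continuous_path H x : {within I `*` setT, continuous (fun q : R * M => H q.1 q.2)} ->
  {within I, continuous (H ^~ x)}.
Proof.
move=> /within_I_continuousP cH; apply/subspace_continuousP => t It B nB.
have [[P Q] [/= tP xQ] PQ] := cH t x It B nB.
rewrite /fmap /= /within /=; apply: filterS tP => s Ps Is.
by apply: (PQ (s, x)) => //; split=> //=; exact: nbhs_singleton.
Qed.

Lemma continuous_measurable_family H :
  {within I `*` setT, continuous (fun q : R * M => H q.1 q.2)} -> measurable_family H.
Proof.
move=> cH; split=> [t|x]; first exact: continuous_slice.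
by apply: subspace_continuous_measurable_fun => //; exact: continuous_path.
Qed.

Lemma space_norm_continuous (nu : {finite_measure set (borel M) -> \bar R}) H :
  {within I `*` setT, continuous (fun q : R * M => H q.1 q.2)} ->
  {within I, continuous (fun t => space_norm nu (H t))}.
Proof.
move=> cH; apply/subspace_continuousP => t It.
apply/cvgrPdist_le => e e0.
have e30 : 0 < e / 3 by rewrite divr_gt0.
have [d d0 Hd] := family_unif_continuous cH e30.
rewrite near_withinE; exists d => // s /= ts Is.
have ct := continuous_slice cH It; have cs := continuous_slice cH Is.
have le h g : continuous h -> continuous g -> (forall x, `|h x - g x| < e / 3) ->
    space_norm nu h - space_norm nu g <= e.
  move=> ch cg hg; have := space_norm_dist M_compact nu ch cg.
  have : space_norm nu (fun x => h x - g x) <= 3 * (e / 3).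
    by apply: space_norm_le => //; [exact: continuousB|move=> x; exact/ltW].
  lra.
have H1 := le _ _ ct cs (fun x => Hd t s x It Is ts).
have H2 : space_norm nu (H s) - space_norm nu (H t) <= e.
  by apply: le => // x; apply: Hd => //; exact: ball_sym.
by rewrite /from_subspace ler_norml; apply/andP; split; lra.
Qed.

End Compact.
End UniformLimits.

(** * The two energies *)

Section EnergyEquality.
Context {R : realType} {n : nat} {M : pseudoPMetricType R}.
Hypothesis M_compact : compact [set: M].
Hypothesis M_hausdorff : hausdorff_space M.
Context {A : smooth_atlas R n.*2.+1 M}.
Variable alpha : one_form A.
Variable nu : {finite_measure set (borel M) -> \bar R}.
Hypothesis nu_neq0 : nu setT != 0%E.
Local Notation I := (`[0%R, 1%R]%classic : set R).
Local Notation smooth_path := (@isotopy_smooth R n M A).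
Implicit Types (F G : R -> M -> M) (H K : R -> M -> R).

Let I0 : I 0. Proof. by rewrite /= in_itv /= lexx ler01. Qed.
Let I1 : I 1. Proof. by rewrite /= in_itv /= lexx ler01. Qed.

Lemma norm_infty_le H C : (forall t, I t -> space_norm nu (H t) <= C) ->
  (norm_infty nu H <= C%:E)%E.
Proof.
by move=> HC; apply: ge_ereal_sup => _ [t It <-]; rewrite lee_fin; exact: HC.
Qed.

Lemma le_norm_infty H t : I t -> ((space_norm nu (H t))%:E <= norm_infty nu H)%E.
Proof. by move=> It; apply: ereal_sup_ubound; exists t. Qed.

Lemma norm_infty_ge0 H : (forall t, I t -> continuous (H t)) ->
  (0 <= norm_infty nu H)%E.
Proof.
move=> cH; apply: le_trans (le_norm_infty H I0).
by rewrite lee_fin; apply: space_norm_ge0 => //; exact: cH.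
Qed.

Lemma norm_1infty_ge0 H : (forall t, I t -> continuous (H t)) ->
  (0 <= norm_1infty nu H)%E.
Proof.
move=> cH; apply: integral_ge0 => t It; rewrite lee_fin.
by apply: space_norm_ge0 => //; exact: cH.
Qed.

Lemma norm_1infty_le_infty H : measurable_family H ->
  (norm_1infty nu H <= norm_infty nu H)%E.
Proof.
move=> mH; have : (0 <= norm_infty nu H)%E by apply: norm_infty_ge0; exact: mH.1.
have := @le_norm_infty H; case: (norm_infty nu H) => [C| |] // HC C0; last by rewrite leey.
have E : (C%:E = \int[@lebesgue_measure R]_(t in I) (cst C%:E t))%E.
  by rewrite integral_cst //= lebesgue_measure_itv /= lte01 oppr0 adde0 mule1.
rewrite [leRHS]E; apply: ge0_le_integral => //.
- move=> t It; rewrite lee_fin; apply: space_norm_ge0 => //; exact: mH.1.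
- by apply/measurable_EFinP; exact: space_norm_measurable.
Qed.

Lemma contact_system_measurable F H : smooth_contact_system alpha F H ->
  measurable_family H.
Proof.
by move=> sFH; apply: continuous_measurable_family; exact: hamiltonian_continuous sFH.
Qed.

(** The change of time for u(t) = ||K_t||; as z' >= 0, the factor z' comes out of the norm. *)
Lemma contact_reparametrization F K e : smooth_contact_system alpha F K -> 0 < e ->
  exists z : R -> R, [/\ forall t, I t -> I (z t), z 1 = 1,
    smooth_on (setT : set R^o) (z : R^o -> R^o),
    smooth_contact_system alpha (fun t => F (z t))
      (fun t x => 'D_1 (z : R^o -> R^o) t * K (z t) x) &
    forall t, I t ->
      ((space_norm nu (fun x => 'D_1 (z : R^o -> R^o) t * K (z t) x))%:E <=
       norm_1infty nu K + e%:E)%E].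
Proof.
move=> sFK e0; have cK := hamiltonian_continuous sFK.
have cu := space_norm_continuous M_compact (nu := nu) cK.
have [] := reparametrization cu _ e0.
  by move=> t It; apply: space_norm_ge0 => //; exact: continuous_slice.
move=> z [sz Iz z0 z1 Dz]; exists z; split=> //.
  exact: contact_system_reparam.
move=> t It; have [D0 DW] := Dz t It; apply: le_trans DW; rewrite lee_fin.
by apply: space_normZ => //; apply: continuous_slice cK _; exact: Iz.
Qed.

(** * Partial products with reparametrized factors, and their limit *)

Section Approximation.
Variables (Phi : R -> M -> M) (H : R -> M -> R).
Hypothesis Phi_iso : topological_isotopy Phi.
Hypothesis H_L1 : L1C0 nu H.
Variables (Phis : nat -> R -> M -> M) (Hs : nat -> R -> M -> R).
Hypothesis Phis_sys : forall k, smooth_contact_system alpha (Phis k) (Hs k).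
Hypothesis Phis_lim : uniform_limit Phis Phi.
Hypothesis Hs_lim : norm_1infty nu (fun t x => H t x - Hs k t x) @[k --> \oo] --> 0%E.
Variable Psis : nat -> R -> M -> M.
Hypothesis Psis_smooth : forall k, smooth_path (Psis k).
Hypothesis PsisK : forall k, inverse_isotopies (Phis k) (Psis k).

Let mH : measurable_family H.
Proof. by have [? ? _] := H_L1. Qed.

Let mHs k : measurable_family (Hs k).
Proof. exact: contact_system_measurable (Phis_sys k). Qed.

Let cPhis k : isotopy_continuous (Phis k).
Proof. by have [[[[]]]] := Phis_sys k. Qed.

Let cPsis k : isotopy_continuous (Psis k).
Proof. by have [] := Psis_smooth k. Qed.

(** All late [Phis k] are close to the single uniformly continuous [Phi]. As d does not depend on k,
    it can be fixed before an index that depends on it. *)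
Lemma Phis_equicontinuous e : 0 < e -> exists2 d, 0 < d &
  exists N, forall k, (N <= k)%N -> forall t x y, I t -> ball x d y ->
    ball (Phis k t x) e (Phis k t y).
Proof.
move=> e0; have e30 : 0 < e / 3 by rewrite divr_gt0.
have [d d0 Hd] := isotopy_unif_continuous M_compact Phi_iso.1 e30.
have [N _ HN] := (uniform_limitP Phis Phi).1 Phis_lim _ e30.
exists d => //; exists N => k Nk t x y It xy.
have -> : e = e / 3 + (e / 3 + e / 3) by field.
apply: ball_triangle (ball_sym (HN k Nk t x It)) _.
exact: ball_triangle (Hd t x y It xy) (HN k Nk t y It).
Qed.

(** The inverses converge uniformly too: y = [Phis k s (Psis k s y)] is close to the image under
    [Phi s] of the same point, and [Psi] is uniformly continuous. Hence phi_i^-1 phi_j is close to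
    phi_j^-1 phi_j = id. *)
Lemma Psis_close e : 0 < e -> exists N, forall i j, (N <= i)%N -> (N <= j)%N ->
  forall s x, I s -> ball x e (Psis i s (Phis j s x)).
Proof.
move=> e0; have [_ [Psi [cPsi PsiK]]] := Phi_iso.
have e20 : 0 < e / 2 by rewrite divr_gt0.
have [d d0 Hd] := isotopy_unif_continuous M_compact cPsi e20.
have [N _ HN] := (uniform_limitP Phis Phi).1 Phis_lim _ d0.
have cl k : (N <= k)%N -> forall s y, I s -> ball (Psi s y) (e / 2) (Psis k s y).
  move=> Nk s y Is; have [_ c1] := PsisK k Is; have [c2 _] := PsiK s Is.
  have := HN k Nk s (Psis k s y) Is; rewrite c1 => h.
  by have := Hd s _ _ Is (ball_sym h); rewrite c2.
exists N => i j Ni Nj s x Is; have [c1 _] := PsisK j Is.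
have := cl j Nj s (Phis j s x) Is; rewrite c1 => h.
by rewrite (splitr e); apply: ball_triangle (ball_sym h) _; exact: cl.
Qed.

Lemma Hs_close e : 0 < e -> exists N, forall k, (N <= k)%N ->
  (norm_1infty nu (fun t x => (H t x - Hs k t x)%R) <= e%:E)%E.
Proof.
move=> e0; have [N _ HN] : \forall k \near \oo,
    (norm_1infty nu (fun t x => (H t x - Hs k t x)%R) < e%:E)%E.
  have : nbhs 0%E [set y | (y < e%:E)%E].
    exact: (nbhs_open_ereal_lt (f := fun=> e) e0).
  by move=> /Hs_lim.
by exists N => k Nk; apply/ltW; exact: HN.
Qed.

Lemma Hs_cauchy e : 0 < e -> exists N, forall i j, (N <= i)%N -> (N <= j)%N ->
  (norm_1infty nu (fun t x => (Hs j t x - Hs i t x)%R) <= e%:E)%E.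
Proof.
move=> e0; have e20 : 0 < e / 2 by rewrite divr_gt0.
have [N HN] := Hs_close e20; exists N => i j Ni Nj.
rewrite (splitr e) EFinD; apply: le_trans (leeD (HN i Ni) (HN j Nj)).
apply: norm_1infty_le => //; try exact: measurable_familyB.
move=> t It; have cH := mH.1 t It; have ci := (mHs i).1 t It; have cj := (mHs j).1 t It.
have c1 := continuousB cH ci; have c2 := continuousB cH cj.
have c3 := continuousB cj ci.
have := space_normD M_compact nu c1 (continuousB cj cH).
rewrite (_ : _ \+ _ = fun x => Hs j t x - Hs i t x); last first.
  by apply/funext => x /=; ring.
move=> h; apply: le_trans h _; rewrite lerD2l.
exact: space_norm_distC.
Qed.

(* The bound on B o phi_i^-1 o phi_j is uniform in the later index j and does
   not depend on the time change, which is what allows the time changes to be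
   chosen after the indices. *)
Lemma choose_index (B : R -> R -> M -> M) e N0 : 0 < e ->
  (forall r, 0 < r -> exists2 d, 0 < d & forall t r' x y, I t -> I r' ->
     ball x d y -> ball (B t r' x) r (B t r' y)) ->
  exists2 i, (N0 <= i)%N & forall j, (i <= j)%N ->
    [/\ forall t r s x, I t -> I r -> I s ->
          ball (B t r (Phis i r x)) e (B t r (Phis i r (Psis i s (Phis j s x)))),
        forall s x, I s -> ball x e (Psis j s (Phis i s x)) &
        (norm_1infty nu (fun t x => (Hs j t x - Hs i t x)%R) <= e%:E)%E].
Proof.
move=> e0 hB; have [d1 d10 H1] := hB e e0.
have [d2 d20 [N1 HN1]] := Phis_equicontinuous d10.
have [N2 HN2] := Psis_close d20; have [N3 HN3] := Psis_close e0.
have [N4 HN4] := Hs_cauchy e0.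
pose i := (N0 + (N1 + (N2 + (N3 + N4))))%N.
exists i => [|j ij]; first by rewrite leq_addr.
split.
- move=> t r s x It Ir Is; apply: H1 => //; apply: HN1 => //; first by rewrite /i; lia.
  by apply: HN2 => //; rewrite /i in ij *; lia.
- by move=> s x Is; apply: HN3 => //; rewrite /i in ij *; lia.
- by apply: HN4; rewrite /i in ij *; lia.
Qed.

Lemma quotient_system i j : smooth_contact_system alpha
  (fun t => Psis i t \o Phis j t)
  (fun t x => - Hs i t (Phis i t x) + Hs j t (Phis i t x)).
Proof.
apply: (contact_system_comp (F' := Phis i)) => //.
  exact: contact_system_inverse.
exact: inverse_isotopies_sym.
Qed.

Lemma quotient_norm i j e :
  (norm_1infty nu (fun t x => (Hs j t x - Hs i t x)%R) <= e%:E)%E ->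
  (norm_1infty nu (fun t x => (- Hs i t (Phis i t x) + Hs j t (Phis i t x))%R)
    <= (3 * e)%:E)%E.
Proof.
move=> He.
have mQ := contact_system_measurable (quotient_system i j).
have mB : measurable_family (fun t x => Hs j t x - Hs i t x).
  exact: measurable_familyB.
apply: (@le_trans _ _ (3%:E * norm_1infty nu (fun t x => (Hs j t x - Hs i t x)%R))%E).
  apply: norm_1infty_mulr_le => // t It; apply: space_norm_le => //.
    exact: mQ.1.
  move=> x; rewrite addrC.
  apply: (norm_le_space_norm M_compact (h := fun x => Hs j t x - Hs i t x)) => //.
  exact: mB.1.
by rewrite EFinM; apply: lee_wpmul2l.
Qed.

(** A partial product F, its inverse, its Hamiltonian and the index reached. The inverse enters the
    next Hamiltonian and must itself converge, so it is carried along. *)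
Definition state := ((R -> M -> M) * (R -> M -> M) * (R -> M -> R) * nat)%type.

(** r is the tolerance for the coming step. The last clause holds for every later index j, which
    leaves the next index free; the equality at time 1 records the telescoping of the product. *)
Definition state_ok (r : R) (u : state) := let: (F, F', G, i) := u in
  [/\ smooth_contact_system alpha F G, smooth_path F', inverse_isotopies F F',
      F 1 = Phis i 1 &
  forall j, (i <= j)%N ->
    [/\ forall t s x, I t -> I s -> ball (F t x) r (F t (Psis i s (Phis j s x))),
        forall s x, I s -> ball x r (Psis j s (Phis i s x)) &
        (norm_1infty nu (fun t x => (Hs j t x - Hs i t x)%R) <= r%:E)%E]].

(** In 4 r, the quotient phi_i^-1 phi_j costs 3 r in the L^(1,oo) norm and its change of time costs
    r. *)
Definition state_close (r : R) (u v : state) :=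
  let: (F, F', G, i) := u in let: (F1, F1', G1, i1) := v in
  (i < i1)%N /\ forall t x, I t -> [/\ ball (F t x) r (F1 t x), ball (F' t x) r (F1' t x) &
    `|G1 t x - G t x| <= 4 * r].

(** One e comes from replacing H by H_i, the other from the change of time. The choice with B the
    identity suffices, because its estimate holds at all times of [Phis i], in particular at
    z(t). *)
Lemma initial_state e : 0 < e -> exists u : state, state_ok e u /\
  let: (F, F', G, i) := u in
  forall t, I t -> ((space_norm nu (G t))%:E <= norm_1infty nu H + (2 * e)%:E)%E.
Proof.
move=> e0; have [N HN] := Hs_close e0.
have [i Ni Hi] := choose_index (B := fun _ _ x => x) N e0
  (fun r r0 => ex_intro2 _ _ r r0 (fun _ _ _ _ _ _ => id)).
have [z [Iz z1 sz sys le]] := contact_reparametrization (Phis_sys i) e0.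
exists (fun t => Phis i (z t), fun t => Psis i (z t),
  fun t x => 'D_1 (z : R^o -> R^o) t * Hs i (z t) x, i); split.
  split=> //.
  - exact: smooth_path_reparam.
  - by move=> t /Iz; exact: PsisK.
  - by rewrite z1.
  - move=> j ij; have [a b c] := Hi j ij; split=> // t s x It Is.
    by apply: (a t) => //; exact: Iz.
move=> t It; apply: le_trans (le t It) _.
have -> : (2 * e)%:E = (e%:E + e%:E)%E by rewrite -EFinD; congr EFin; ring.
rewrite addeA leeD2r //; apply: le_trans (leeD2l _ (HN i Ni)).
apply: norm_1infty_le => //; first exact: measurable_familyB.
move=> s Is; have cH := mH.1 s Is; have ci := (mHs i).1 s Is.
apply: le_trans (space_norm_dist M_compact nu ci cH) _.
by rewrite lerD2l; exact: space_norm_distC.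
Qed.

Lemma next_state r r' u : 0 < r -> 0 < r' -> state_ok r u ->
  exists v, state_ok r' v /\ state_close r u v.
Proof.
move=> r0 r'0; case: u => [[[F F'] G] i] [sFG sF' FK F1 Fi].
(* At q = z(t), B(t, q) o phi_i1(q) is the new product. Leaving q free allows i1 to be chosen before
   z, which depends on i1. *)
pose B t q := F t \o Psis i q.
have hB e : 0 < e -> exists2 d, 0 < d & forall t q x y, I t -> I q ->
    ball x d y -> ball (B t q x) e (B t q y).
  move=> e0; have cF : isotopy_continuous F by have [[[[]]]] := sFG.
  have [d1 d10 H1] := isotopy_unif_continuous M_compact cF e0.
  have [d2 d20 H2] := isotopy_unif_continuous M_compact (@cPsis i) d10.
  by exists d2 => // t q x y It Iq xy; apply: H1 => //; exact: H2.
have [i1 ii1 Hi1] := choose_index i.+1 r'0 hB.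
have [a b c] := Fi i1 (ltnW ii1).
have [z [Iz z1 sz sys le]] := contact_reparametrization (quotient_system i i1) r0.
pose K t x := 'D_1 (z : R^o -> R^o) t *
  (- Hs i (z t) (Phis i (z t) x) + Hs i1 (z t) (Phis i (z t) x)).
have Kle t x : I t -> `|K t x| <= 4 * r.
  move=> It; have cK : continuous (K t).
    by have := (contact_system_measurable sys).1; exact.
  apply: le_trans (norm_le_space_norm M_compact x nu_neq0 cK) _.
  rewrite -lee_fin; apply: le_trans (le t It) _.
  have -> : (4 * r)%:E = ((3 * r)%:E + r%:E)%E by rewrite -EFinD; congr EFin; ring.
  by rewrite leeD2r //; exact: quotient_norm.
exists (fun t => F t \o (Psis i (z t) \o Phis i1 (z t)),
        fun t => (Psis i1 (z t) \o Phis i (z t)) \o F' t,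
        fun t x => G t x + K t (F' t x), i1); split.
  split.
  - exact: contact_system_comp sFG sys FK.
  - apply: smooth_path_comp => //.
    apply: (smooth_path_comp (F := fun t => Psis i1 (z t)) (G := fun t => Phis i (z t))).
      exact: smooth_path_reparam.
    by apply: smooth_path_reparam => //; have [[[]]] := Phis_sys i.
  - move=> t It; have [k1 k2] := FK t It; have Izt := Iz t It.
    have [p1 p2] := PsisK i Izt; have [q1 q2] := PsisK i1 Izt.
    by split=> x /=; rewrite ?k1 ?p2 ?q1 // ?q2 ?p1 ?k2.
  - apply/funext => x /=; rewrite z1 F1; exact: (PsisK i I1).2.
  - move=> j ij; have [a' b' c'] := Hi1 j ij; split=> // t s x It Is.
    by have := a' t (z t) s x It (Iz t It) Is.
split=> // t x It; split.
- by apply: a => //; exact: Iz.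
- by apply: b; exact: Iz.
- by rewrite addrAC subrr add0r; exact: Kle.
Qed.

(** X(Y(x)) is near X(Y_j(x)) by uniform continuity of X, and this is near X_j(Y_j(x)) = x; in a
    Hausdorff M, points at arbitrarily small distance coincide. *)
Lemma cancel_limit (Xs Ys : nat -> R -> M -> M) X Y t :
  I t -> isotopy_continuous X ->
  (forall e, 0 < e -> exists k, forall j, (k <= j)%N -> forall x,
    ball (X t x) e (Xs j t x) /\ ball (Y t x) e (Ys j t x)) ->
  (forall k, cancel (Ys k t) (Xs k t)) -> cancel (Y t) (X t).
Proof.
move=> It cX lim XYs x; apply: (close_eq M_hausdorff); rewrite ball_close.
move=> e'; have e0 : 0 < e'%:num by [].
move: (e'%:num) e0 => e e0; have e20 : 0 < e / 2 by rewrite divr_gt0.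
have [d d0 Hd] := isotopy_unif_continuous M_compact cX e20.
have [k1 H1] := lim _ e20; have [k2 H2] := lim _ d0.
pose k := (k1 + k2)%N.
have [_ h2] := H2 k (leq_addl _ _) x.
have [h1 _] := H1 k (leq_addr _ _) (Ys k t x).
rewrite (splitr e); apply: ball_triangle (Hd t _ _ It h2) _.
by move: h1; rewrite XYs.
Qed.

(** The limit of states with tolerances e / 2^k. In 47 e, the initial state accounts for 2 e; the
    limit Hamiltonian is within 15 e of the initial one in the sup norm, and the factor 3 turns this
    into 45 e. *)
Lemma continuous_approximation e : 0 < e -> exists F K,
  [/\ continuous_contact_system alpha nu F K, F 1 = Phi 1 &
      (norm_infty nu K <= norm_1infty nu H + (47 * e)%:E)%E].
Proof.
move=> e0; have [u0 [ok0 le0]] := initial_state e0.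
pose r k := e * 2^-1 ^+ k.
have r0 k : 0 < r k by exact: geometric_gt0.
have [||u [u0E uP]] := @dependent_choice_seq state
  (fun k => state_ok (r k)) (fun k => state_close (r k)) u0.
- by rewrite /r expr0 mulr1.
- by move=> k v okv; exact: next_state.
pose Fs k := (u k).1.1.1; pose Gs k := (u k).1.1.2; pose Ks k := (u k).1.2.
have ok k : [/\ smooth_contact_system alpha (Fs k) (Ks k), smooth_path (Gs k),
      inverse_isotopies (Fs k) (Gs k) & Fs k 1 = Phis (u k).2 1].
  by have [] := uP k; rewrite /Fs /Gs /Ks; case: (u k) => [[[F G] K] i] [].
have cl k : ((u k).2 < (u k.+1).2)%N /\ forall t x, I t ->
    [/\ ball (Fs k t x) (r k) (Fs k.+1 t x),
        ball (Gs k t x) (r k) (Gs k.+1 t x) & `|Ks k.+1 t x - Ks k t x| <= 4 * r k].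
  have [_] := uP k; rewrite /Fs /Gs /Ks.
  by case: (u k) => [[[F G] K] i]; case: (u k.+1) => [[[F1 G1] K1] i1]; exact.
have uk k : (k <= (u k).2)%N.
  by elim: k => [//|k IH]; apply: leq_ltn_trans IH (cl k).1.
have M_complete (B : set_system M) : ProperFilter B -> cauchy B -> cvg B.
  by move=> PB cB; apply: (compact_cauchy_cvg PB cB _ M_compact); exact: filterT.
have [|F FE] := geometric_limit M_complete e0 (Fs := Fs).
  by move=> k t x It; have [] := (cl k).2 t x It.
have [|G GE] := geometric_limit M_complete e0 (Fs := Gs).
  by move=> k t x It; have [] := (cl k).2 t x It.
(* Increments are known to be at most 4 r_k and balls are strict, whence 5. *)
have e50 : 0 < 5 * e by rewrite mulr_gt0.
have [||K KE] := @geometric_limit R M R _ Ks (5 * e) e50.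
- by move=> B PB; exact: cauchy_cvg.
- move=> k t x It; have [_ _ h] := (cl k).2 t x It.
  rewrite -mulrA -/(r k) -ball_normE /= distrC; apply: le_lt_trans h _.
  by have := r0 k; lra.
have {}KE k t x : I t -> `|K t x - Ks k t x| <= 15 * r k.
  move=> It; have := KE k t x It; rewrite -ball_normE /= => /ltW h.
  by apply: le_trans h _; rewrite /r; lra.
(* 16 exceeds both constants at hand, 3 for the isotopies and 15 for the Hamiltonians. *)
have small d : 0 < d -> exists k, forall j, (k <= j)%N -> 16 * r j < d.
  move=> d0; have d160 : 0 < d / 16 by rewrite divr_gt0.
  have [k Hk] := geometric_small e0 d160.
  by exists k => j /Hk; rewrite -/(r j); lra.
have lim d : 0 < d -> exists k, forall j, (k <= j)%N -> forall t x, I t ->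
    ball (F t x) d (Fs j t x) /\ ball (G t x) d (Gs j t x).
  move=> d0; have [k Hk] := small d d0; exists k => j kj t x It.
  have h : 3 * r j <= d by have := Hk j kj; have := r0 j; lra.
  by split; [exact: le_ball h _ (FE j t x It)|exact: le_ball h _ (GE j t x It)].
have cF : isotopy_continuous F.
  apply: (continuous_of_close (Fs := Fs)) => [d d0|k].
    by have [k Hk] := lim d d0; exists k => t x It; have [] := Hk k (leqnn _) t x It.
  by have [[[[[]]]]] := ok k.
have cG : isotopy_continuous G.
  apply: (continuous_of_close (Fs := Gs)) => [d d0|k].
    by have [k Hk] := lim d d0; exists k => t x It; have [] := Hk k (leqnn _) t x It.
  by have [_ []] := ok k.
have FG : inverse_isotopies F G.
  move=> t It; split.
    apply: (cancel_limit (Xs := Gs) (Ys := Fs)) => // [d d0|k].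
      have [k Hk] := lim d d0; exists k => j kj x.
      by have [] := Hk j kj t x It.
    by have [_ _ /(_ t It)[]] := ok k.
  apply: (cancel_limit (Xs := Fs) (Ys := Gs)) => // [d d0|k].
    have [k Hk] := lim d d0; exists k => j kj x.
    by have [] := Hk j kj t x It.
  by have [_ _ /(_ t It)[]] := ok k.
have cK : {within I `*` setT, continuous (fun q : R * M => K q.1 q.2)}.
  apply: (continuous_of_close (Y := R) (Fs := Ks)) => [d d0|k].
    have [k Hk] := small d d0; exists k => t x It; rewrite -ball_normE /=.
    by apply: le_lt_trans (KE k t x It) _; have := Hk k (leqnn _); have := r0 k; lra.
  by have [sFK _ _ _] := ok k; exact: hamiltonian_continuous sFK.
have cKs k t : I t -> continuous (Ks k t).
  by move=> It; have [sFK _ _ _] := ok k; exact: (contact_system_measurable sFK).1.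
have cKt t : I t -> continuous (K t) by move=> It; exact: continuous_slice cK It.
have KsE k t : I t -> space_norm nu (fun x => K t x - Ks k t x) <= 45 * r k.
  move=> It; have -> : 45 * r k = 3 * (15 * r k) by ring.
  apply: space_norm_le => [//||x]; last exact: KE.
  by apply: continuousB; [exact: cKt|exact: cKs].
exists F, K; split.
- split=> //; first by split=> //; exists G.
  exists Fs, Ks; split.
  + by move=> k; have [] := ok k.
  + apply/uniform_limitP => d d0; have [k Hk] := lim d d0.
    by exists k => // j /= kj t x It; have [] := Hk j kj t x It.
  + apply: (@squeeze_cvge _ _ _ _ (fun=> 0%E) _ (fun k => (45 * e * 2^-1 ^+ k)%:E)).
    * apply: nearW => k; apply/andP; split.
        by apply: norm_infty_ge0 => t It; apply: continuousB; [exact: cKt|exact: cKs].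
      by apply: norm_infty_le => t It; rewrite -mulrA; exact: KsE.
    * exact: cvg_cst.
    * apply: cvg_EFin; first exact: nearW.
      by apply: cvg_geometric; rewrite ger0_norm // invf_lt1 // ltr1n.
(* The time-one map of the k-th product is that of [Phis] at an index at least k, so these maps
   converge to [Phi 1]. *)
- apply/funext => x; apply: (close_eq M_hausdorff); rewrite ball_close.
  move=> d'; have d0 : 0 < d'%:num by [].
  move: (d'%:num) d0 => d d0; have d20 : 0 < d / 2 by rewrite divr_gt0.
  have [N _ HN] := (uniform_limitP Phis Phi).1 Phis_lim _ d20.
  have [k Hk] := lim _ d20; pose j := (k + N)%N.
  have [h _] := Hk j (leq_addr _ _) 1 x I1.
  have [_ _ _ E] := ok j; rewrite E in h.
  rewrite (splitr d); apply: ball_triangle h _; apply: ball_sym.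
  by apply: HN => //=; apply: leq_trans (uk j); exact: leq_addl.
- apply: ge_ereal_sup => _ [t It <-].
  have le1 : ((space_norm nu (Ks 0%N t))%:E <= norm_1infty nu H + (2 * e)%:E)%E.
    by move: le0; rewrite /Ks u0E; case: (u0) => [[[F1 G1] K1] i1] /(_ t It).
  have -> : (47 * e)%:E = ((2 * e)%:E + (45 * e)%:E)%E by rewrite -EFinD; congr EFin; ring.
  rewrite addeA; apply: le_trans (leeD2r _ le1); rewrite -EFinD lee_fin.
  apply: le_trans (space_norm_dist M_compact nu (cKt t It) (cKs 0%N t It)) _.
  by rewrite lerD2l; have := KsE 0%N t It; rewrite /r expr0 mulr1.
Qed.

End Approximation.

Lemma continuous_topological F K : continuous_contact_system alpha nu F K ->
  topological_contact_system alpha nu F K.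
Proof.
move=> [iF cK [Fs [Ks [sFs uF KsE]]]]; have mK := continuous_measurable_family cK.
have [B _ HB] : exists2 B, 0 <= B & forall t, I t -> space_norm nu (K t) <= B.
  have cu := space_norm_continuous M_compact (nu := nu) cK.
  have [B B0 HB] := itv01_bounded cu.
  by exists B => // t It; apply: le_trans (ler_norm _) (HB t It).
split=> //.
- split; [exact: mK.1|exact: mK.2|].
  apply: le_lt_trans (norm_1infty_le_infty mK) _.
  by apply: le_lt_trans (norm_infty_le HB) _; exact: ltry.
- exists Fs, Ks; split=> //.
  have mB k : measurable_family (fun t x => K t x - Ks k t x).
    by apply: measurable_familyB => //; exact: contact_system_measurable (sFs k).
  apply: (squeeze_cvge _ (@cvg_cst _ _ _ _ _) KsE).
  apply: nearW => k; rewrite norm_1infty_le_infty // andbT.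
  by apply: norm_1infty_ge0; exact: (mB k).1.
Qed.

Lemma energy_1infty_le phi : (energy_1infty alpha nu phi <= energy_infty alpha nu phi)%E.
Proof.
apply: le_ereal_inf_tmp => _ [F [K [sFK F1 ->]]].
have tFK := continuous_topological sFK.
apply: le_trans (_ : norm_1infty nu K <= _)%E.
  by apply: ereal_inf_lbound; exists F, K.
by apply: norm_1infty_le_infty; have [_ cK _] := sFK; exact: continuous_measurable_family.
Qed.

Lemma energy_infty_le phi : (energy_infty alpha nu phi <= energy_1infty alpha nu phi)%E.
Proof.
apply: le_ereal_inf_tmp => _ [F [K [[iF LK [Fs [Ks [sFs uF KsE]]]] F1 ->]]].
have [Gs GsP] : exists Gs : nat -> R -> M -> M, forall k,
    smooth_path (Gs k) /\ inverse_isotopies (Fs k) (Gs k).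
  have ex k : {G | smooth_path G /\ inverse_isotopies (Fs k) G}.
    by apply: cid; have [[[_ [G GP]] _ _] _] := sFs k; exists G.
  by exists (fun k => sval (ex k)) => k; exact: (svalP (ex k)).
apply/lee_addgt0Pr => e e0; have e470 : 0 < e / 47 by rewrite divr_gt0.
have [Phi [H [sPH P1 PH]]] := continuous_approximation iF LK sFs uF KsE
  (fun k => (GsP k).1) (fun k => (GsP k).2) e470.
apply: (@le_trans _ _ (norm_infty nu H)).
  by apply: ereal_inf_lbound; exists Phi, H; split=> //; rewrite P1.
by move: PH; rewrite mulrC divfK.
Qed.

End EnergyEquality.

Theorem theorem10p7
  (R : realType) (n : nat) (M : pseudoPMetricType R)
  (M_compact : compact [set: M])
  (M_hausdorff : hausdorff_space M)
  (M_connected : connected [set: M])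
  (A : smooth_atlas R n.*2.+1 M)
  (alpha : one_form A)
  (alpha_contact : contact_form alpha)
  (nu : {finite_measure set (borel M) -> \bar R})
  (nu_volume : contact_volume alpha nu)
  (phi : M -> M) (phi_homeo : Homeo alpha nu phi) :
  energy_1infty alpha nu phi = energy_infty alpha nu phi.

Proof.
have nu_neq0 := contact_volume_neq0 alpha_contact nu_volume.
by apply/eqP; rewrite eq_le energy_1infty_le //= energy_infty_le.
Qed.
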